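(* Let $l,N\ge 1$, let $\lambda=(\lambda_1,\dots,\lambda_{l+N})$ be a generalized partition, and let $y^{\pm}=(y_1^{\pm1},\dots,y_l^{\pm1})$, $x^{\pm}=(x_1^{\pm1},\dots,x_N^{\pm1})$. Then $$so_\lambda(y^{\pm};x^{\pm})=\sum_{\mu=(\mu_1,\dots,\mu_l)}so_\mu(y^{\pm})\,so_{\lambda/\mu}(x^{\pm}),$$ where the sum is over all generalized partitions $\mu$ with $l$ entries, $so_\lambda(y^{\pm};x^{\pm})$ is the odd orthogonal character in the $l+N$ variables $y_1,\dots,y_l,x_1,\dots,x_N$, and $so_{\lambda/\mu}(x^\pm)=\langle\mu^{so}|\Gamma_+(x^{\pm})|\lambda^{so}\rangle$ is the skew odd orthogonal character.
   Context: A generalized partition is a weakly decreasing finite sequence of nonnegative integers (zeros allowed; the number of entries is recorded). The odd orthogonal character (irreducible character of $SO_{2n+1}(\mathbb C)$) attached to $\nu=(\nu_1,\dots,\nu_n)$ in $n$ variables is $$so_\nu(x^{\pm})=\frac{\det\big(x_i^{\nu_j+(n-j+\frac12)}-x_i^{-\nu_j-(n-j+\frac12)}\big)_{i,j=1}^n}{\det\big(x_i^{n-j+\frac12}-x_i^{-(n-j+\frac12)}\big)_{i,j=1}^n}.$$ Heisenberg algebra: generators $a_n$ ($n\in\mathbb Z\setminus\{0\}$) with $[a_m,a_n]=m\delta_{m,-n}$. The Fock space $\mathcal M$ is generated by the vacuum $|0\rangle$ with $a_n|0\rangle=0$ for $n>0$ (so $\mathcal M\cong\mathbb C[a_{-1},a_{-2},\dots]$),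 and $\langle 0|$ is the dual vacuum, a linear functional on $\mathcal M$ with $\langle 0|a_{-n}=0$ for $n>0$ and $\langle 0|1|0\rangle=1$. Vertex operators: $$U(z)=(1+z)\exp\Big(\sum_{n\ge1}\tfrac{a_{-n}}{n}z^n\Big)\exp\Big(-\sum_{n\ge1}\tfrac{a_n}{n}(z^n+z^{-n})\Big)=\sum_{n\in\mathbb Z}U_nz^{-n},$$ $$U^*(z)=(1-z)\exp\Big(-\sum_{n\ge1}\tfrac{a_{-n}}{n}z^n\Big)\exp\Big(\sum_{n\ge1}\tfrac{a_n}{n}(z^n+z^{-n})\Big)=\sum_{n\in\mathbb Z}U^*_nz^{n}.$$ For a generalized partition $\lambda=(\lambda_1,\dots,\lambda_k)$, $$|\lambda^{so}\rangle=U_{-\lambda_1}\cdots U_{-\lambda_k}|0\rangle,\qquad \langle\lambda^{so}|=\langle0|U^*_{-\lambda_k}\cdots U^*_{-\lambda_1}$$ (the latter is a linear functional on $\mathcal M$ and depends on the number $k$ of entries). Finally $\Gamma_+(z)=\exp\big(\sum_{n\ge1}\frac{a_n}{n}z^n\big)$ and $\Gamma_+(x^{\pm})=\prod_{i=1}^N\Gamma_+(x_i)\Gamma_+(x_i^{-1})$. *)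

(* Defs.v *)
From HB Require Import structures.
From mathcomp Require Import all_boot all_order all_algebra.
From mathcomp Require Import fraction complex.
From mathcomp Require Import boolp classical_sets functions cardinality fsbigop.
From mathcomp Require Import reals.
From mathcomp Require Import mpoly.

Set Implicit Arguments.
Unset Strict Implicit.
Unset Printing Implicit Defensive.

Import GRing.Theory.

Local Open Scope classical_set_scope.
Local Open Scope ring_scope.

(* The number of entries of a generalized partition is the size of the
   sequence; zero entries are allowed and are not dropped. *)
Definition gen_partition (s : seq nat) : bool := sorted geq s.

(* [heis 0] is unconstrained and never used. *)
Record fockSpace (C : fieldType) := FockSpace {
  fock_sort :> lmodType C;
  heis : int -> {linear fock_sort -> fock_sort};
  vac : fock_sort;
  dvac : {scalar fock_sort};
  heis_comm : forall m n : int, m != 0 -> n != 0 -> forall w : fock_sort,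
    heis m (heis n w) - heis n (heis m w)
      = (if m == - n then m%:~R else 0) *: w;
  heis_vac : forall n : int, 0 < n -> heis n vac = 0;
  vac_generates : forall P : fock_sort -> Prop,
    P vac ->
    (forall (c : C) (u v : fock_sort), P u -> P v -> P (c *: u + v)) ->
    (forall (n : int) (w : fock_sort), n != 0 -> P w -> P (heis n w)) ->
    forall w, P w;
  dvac_heis : forall (n : int) (w : fock_sort), 0 < n -> dvac (heis (- n) w) = 0;
  dvac_vac : dvac vac = 1
}.

Section FormalDistributions.
Variables (C : fieldType) (V : lmodType C).

(* A function [int -> X] stands for the two-sided formal series whose
   coefficient of z^k is its value at k.  The operator sums \sum_(_ \in _) are
   sums of finitely many nonzero terms, which is the case for each use made of
   them below. *)

Definition dist_const (w : V) : int -> V := fun k => if k == 0 then w else 0.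

Definition dist_opp (A : int -> V -> V) : int -> V -> V := fun k w => - A k w.

Definition dist_act (A : int -> V -> V) (F : int -> V) : int -> V :=
  fun k => \sum_(j \in [set: int]) A j (F (k - j)).

(* exp(A(z)) F(z) *)
Definition dist_exp (A : int -> V -> V) (F : int -> V) : int -> V :=
  fun k => \sum_(m \in [set: nat]) (m`!%:R)^-1 *: iter m (dist_act A) F k.

End FormalDistributions.

Section VertexOperators.
Variables (C : fieldType) (M : fockSpace C).

(* \sum_(n >= 1) a_{-n} / n z^n *)
Definition heis_cre (k : int) (w : M) : M :=
  if 0 < k then k%:~R^-1 *: heis M (- k) w else 0.

(* \sum_(n >= 1) a_n / n z^n *)
Definition heis_ann (k : int) (w : M) : M :=
  if 0 < k then k%:~R^-1 *: heis M k w else 0.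

(* \sum_(n >= 1) a_n / n (z^n + z^{-n}) *)
Definition heis_ann_sym (k : int) (w : M) : M := heis_ann k w + heis_ann (- k) w.

(* U(z) w, with the factor 1 + z left out *)
Definition U_core (w : M) : int -> M :=
  dist_exp heis_cre (dist_exp (dist_opp heis_ann_sym) (dist_const w)).

(* U*(z) w, with the factor 1 - z left out *)
Definition Ustar_core (w : M) : int -> M :=
  dist_exp (dist_opp heis_cre) (dist_exp heis_ann_sym (dist_const w)).

(* U(z) = \sum_n U_n z^{-n} whereas U*(z) = \sum_n U*_n z^n. *)
Definition U_mode (n : int) (w : M) : M := U_core w (- n) + U_core w (- n - 1).

Definition Ustar_mode (n : int) (w : M) : M :=
  Ustar_core w n - Ustar_core w (n - 1).

Definition so_ket (lambda : seq nat) : M :=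
  foldr (fun p w => U_mode (- p%:Z) w) (vac M) lambda.

(* <0| U*_{-mu_k} ... U*_{-mu_1}: the first entry acts first. *)
Definition so_bra (mu : seq nat) (w : M) : C :=
  dvac M (foldl (fun v p => Ustar_mode (- p%:Z) v) w mu).

(* Coefficient of z^k in Gamma_+(z). *)
Definition Gamma_mode (k : nat) (w : M) : M :=
  dist_exp heis_ann (dist_const w) k%:Z.

(* Coefficient of \prod_i u_i^(e i).1 v_i^(e i).2 in
   \prod_i Gamma_+(u_i) Gamma_+(v_i). *)
Definition Gamma_pm_mode (N : nat) (e : {ffun 'I_N -> nat * nat}) (w : M) : M :=
  foldr (fun i v => Gamma_mode (e i).1 (Gamma_mode (e i).2 v)) w (enum 'I_N).

(* <mu^so| Gamma_+(x^{+-}) |lambda^so>, expanded in powers of the variables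
   x_i, which live in an extension [iota] of C. *)
Definition skew_so (K : fieldType) (iota : {rmorphism C -> K}) (N : nat)
    (lambda mu : seq nat) (x : 'I_N -> K) : K :=
  \sum_(e \in [set: {ffun 'I_N -> nat * nat}])
    iota (so_bra mu (Gamma_pm_mode e (so_ket lambda)))
      * \prod_(i < N) (x i ^+ (e i).1 * (x i)^-1 ^+ (e i).2).

End VertexOperators.

(* The odd orthogonal character of nu in the variables x_i = t_i ^+ 2; the
   square roots t_i account for the half-integer exponents.  Columns are
   numbered from 0, so 2 (nu_j + n - j + 1/2) becomes 2 (nu_j + n - j.+1) + 1. *)
Definition so_exponent (n : nat) (nu : n.-tuple nat) (j : 'I_n) : nat :=
  (tnth nu j + (n - j.+1)).*2.+1.

Definition so_alternant (K : fieldType) (n : nat) (nu : n.-tuple nat)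
    (t : 'I_n -> K) : K :=
  \det (\matrix_(i < n, j < n)
          (t i ^+ so_exponent nu j - t i ^- so_exponent nu j)).

Definition so_char (K : fieldType) (n : nat) (nu : n.-tuple nat)
    (t : 'I_n -> K) : K :=
  so_alternant nu t / so_alternant [tuple of nseq n 0%N] t.

(* The field generated over C by formal square roots of n variables. *)
Definition sqrt_field (C : fieldType) (n : nat) : fieldType :=
  {fraction {mpoly C[n]}}.

Definition sqrt_var (C : fieldType) (n : nat) (i : 'I_n) : sqrt_field C n :=
  tofrac ('X_i : {mpoly C[n]}).

Definition sqrt_field_cst (C : fieldType) (n : nat) :
  {rmorphism C -> sqrt_field C n} := @tofrac {mpoly C[n]} \o @mpolyC n C.

(* Main.v *)
Require Import Defs.
From HB Require Import structures.
From mathcomp Require Import all_boot all_order all_algebra.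
From mathcomp Require Import fraction complex.
From mathcomp Require Import boolp classical_sets functions cardinality fsbigop.
From mathcomp Require Import reals.
From mathcomp Require Import mpoly.
From mathcomp Require Import fingroup perm.
From mathcomp Require Import zify ring.

Set Implicit Arguments.
Unset Strict Implicit.
Unset Printing Implicit Defensive.

Import Order.TTheory GRing.Theory Num.Theory.

Local Open Scope classical_set_scope.
Local Open Scope ring_scope.

(* Commuting past a creation operator a_{-n} determines every operator in
   sight up to its value on the vacuum, and M is spanned by creation words, so
   each identity between vertex operators is only checked on the vacuum, where
   both sides satisfy the same first-order (Euler) recursion.

   In this way one gets the exchange relations of the modes U_n and U*_n, hence
   the orthonormality of the bras and kets with the same number of entries.  The
   relations also make m |-> <m|w>, for m in Z^n shifted by rho, antisymmetric
   under the hyperoctahedral group, so that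
     R(w) = \sum_(m in Z^n) <m|w> t^(m + rho)
          = \sum_(mu) <mu|w> * alternant_mu(t),
   and R(a_{-n} w) = p_n R(w) with p_n the power sum of the variables y_i^{+-1}.
   Therefore R / R(vac), where R(vac) is the Weyl denominator, is the functional
   w |-> <0| Gamma_+(y^{+-}) w >.  Applying this to the l variables y, inserting
   Gamma_+(x^{+-}), and comparing with all l + N variables at once, the
   branching rule follows from the uniqueness of a functional with prescribed
   a_{-n}-eigenvalues and value on the vacuum. *)

(** The Fock space is given by generators and relations only, with neither a polynomial model nor a
    grading; finiteness of the operator sums is drawn from the filtration [deg_le], in which
    negative degree means zero.

    Put P = (1 - z w)(1 - w / z) = exp(- \sum_n (z^n + z^{-n}) w^n / n). Normal ordering multiplies
    a product of two vertex operators by P when they are of the same kind and by 1 / P when they are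
    of opposite kinds. Since 1 / P expands differently in the two orders, identities with 1 / P are
    stated after multiplication by factors of P, and the two expansions of 1 / (1 - w / z) leave a
    delta function.

    The prefactors 1 + z and 1 - z clear the remaining factor 1 - z w, and under z -> 1 / z they
    yield the reflection of the index at the dual vacuum, the last generator of the hyperoctahedral
    group. In the coordinates shifted by rho the reflection is q -> - q - 1, a sign change of q +
    1/2; with y = t^2 this half-integer becomes the odd exponent 2 q + 1 of t. *)

(* The square-zero extension C (+) V is a commutative ring, so that [ring]
   decides identities in the C-module V. *)
Section SquareZeroExtension.
Variables (C : comNzRingType) (V : lmodType C).

Definition sqz := (C * V)%type.
HB.instance Definition _ := GRing.Zmodule.on sqz.

Definition sqz_one : sqz := (1, 0).
Definition sqz_mul (x y : sqz) : sqz := (x.1 * y.1, x.1 *: y.2 + y.1 *: x.2).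

Lemma sqz_mulA : associative sqz_mul.
Proof.
move=> [a u] [b v] [c w]; congr (_, _); rewrite /= ?mulrA //.
by rewrite !scalerDr !scalerA addrA [c * a]mulrC [c * b]mulrC.
Qed.

Lemma sqz_mulC : commutative sqz_mul.
Proof. by move=> [a u] [b v]; congr (_, _); rewrite /= 1?mulrC 1?addrC. Qed.

Lemma sqz_mul1 : left_id sqz_one sqz_mul.
Proof. by move=> [a u]; congr (_, _); rewrite /= ?mul1r // scale1r scaler0 addr0. Qed.

Lemma sqz_mulDl : left_distributive sqz_mul +%R.
Proof.
move=> [a u] [b v] [c w]; congr (_, _); rewrite /= ?mulrDl //.
by rewrite scalerDl scalerDr addrACA.
Qed.

Lemma sqz_one_neq0 : sqz_one != 0.
Proof. by apply/eqP => -[/eqP]; rewrite oner_eq0. Qed.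

HB.instance Definition _ := GRing.Zmodule_isComNzRing.Build sqz
  sqz_mulA sqz_mulC sqz_mul1 sqz_mulDl sqz_one_neq0.

Definition sqz_vec (v : V) : sqz := (0, v).
Definition sqz_cst (c : C) : sqz := (c, 0).

Fact sqz_vec_additive : zmod_morphism sqz_vec.
Proof. by move=> u v; congr (_, _); rewrite ?subr0. Qed.
HB.instance Definition _ := GRing.isZmodMorphism.Build V sqz sqz_vec sqz_vec_additive.

Fact sqz_cst_additive : zmod_morphism sqz_cst.
Proof. by move=> u v; congr (_, _); rewrite ?subr0. Qed.
HB.instance Definition _ := GRing.isZmodMorphism.Build C sqz sqz_cst sqz_cst_additive.
Fact sqz_cst_multiplicative : monoid_morphism sqz_cst.
Proof. by split=> // u v; congr (_, _); rewrite /= !scaler0 addr0. Qed.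
HB.instance Definition _ :=
  GRing.isMonoidMorphism.Build C sqz sqz_cst sqz_cst_multiplicative.

Lemma sqz_vecZ c v : sqz_vec (c *: v) = sqz_cst c * sqz_vec v.
Proof. by congr (_, _); rewrite /= ?mulr0 // scaler0 addr0. Qed.

Lemma sqz_vecD u v : sqz_vec (u + v) = sqz_vec u + sqz_vec v.
Proof. exact: raddfD. Qed.

Lemma sqz_vecN v : sqz_vec (- v) = - sqz_vec v.
Proof. exact: raddfN. Qed.

Lemma sqz_vec0 : sqz_vec 0 = 0.
Proof. by []. Qed.

Lemma sqz_vec_inj : injective sqz_vec.
Proof. by move=> u v []. Qed.

End SquareZeroExtension.

Ltac lmod_ring :=
  apply: sqz_vec_inj; rewrite ?(sqz_vecD, sqz_vecN, sqz_vecZ, sqz_vec0); ring.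


(** * Sums with finite support *)

Section FiniteSums.
Variables (I : choiceType) (V : zmodType).
Implicit Types F G : I -> V.

Lemma fsumT_seq (r : seq I) F : (forall i, i \notin r -> F i = 0) ->
  \sum_(i \in [set: I]) F i = \sum_(i <- undup r) F i.
Proof.
move=> F0; rewrite (fsbigE (undup r)) ?undup_uniq //.
  by apply: eq_bigl => i; rewrite in_setT.
by move=> i _; rewrite mem_undup; exact: F0.
Qed.

Definition fin_supp F := finite_set [set i | F i != 0].

Lemma fin_suppP F : fin_supp F <-> exists r : seq I, forall i, i \notin r -> F i = 0.
Proof.
split=> [/finite_seqP[r Er]|[r F0]].
  exists r => i ir; apply/eqP; apply: contraNT ir => Fi.
  by have : [set i | F i != 0] i by []; rewrite Er.
apply: (sub_finite_set _ (finite_seq r)) => i /= Fi.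
by apply: contraNT Fi => /F0 ->.
Qed.

Lemma fin_supp_seq2 F G : fin_supp F -> fin_supp G ->
  exists r : seq I, forall i, i \notin r -> F i = 0 /\ G i = 0.
Proof.
move=> /fin_suppP[r Fr] /fin_suppP[s Gs]; exists (r ++ s) => i.
by rewrite mem_cat negb_or => /andP[/Fr -> /Gs ->].
Qed.

Lemma fsumTD F G : fin_supp F -> fin_supp G ->
  \sum_(i \in [set: I]) (F i + G i) =
  \sum_(i \in [set: I]) F i + \sum_(i \in [set: I]) G i.
Proof.
move=> Ff Gf; have [r rP] := fin_supp_seq2 Ff Gf.
by rewrite !(@fsumT_seq r) ?big_split // => i /rP[Fi Gi]; rewrite ?Fi ?Gi ?addr0.
Qed.

Lemma fin_suppD F G : fin_supp F -> fin_supp G -> fin_supp (fun i => F i + G i).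
Proof.
move=> Ff Gf; have [r rP] := fin_supp_seq2 Ff Gf.
by apply/fin_suppP; exists r => i /rP[-> ->]; rewrite addr0.
Qed.

Lemma fin_supp_comp (W : zmodType) (f : V -> W) F :
  f 0 = 0 -> fin_supp F -> finite_set [set i | f (F i) != 0].
Proof.
move=> f0; apply: sub_finite_set => i /=; apply: contraNN => /eqP ->.
exact/eqP.
Qed.

End FiniteSums.

Lemma fsum_nat (V : zmodType) (F : nat -> V) (N : nat) :
  (forall m, (N <= m)%N -> F m = 0) ->
  \sum_(m \in [set: nat]) F m = \sum_(m < N) F m.
Proof.
move=> F0; rewrite (@fsumT_seq _ _ (iota 0 N)) ?undup_id ?iota_uniq //.
  by rewrite -(big_mkord xpredT) /index_iota subn0.
by move=> m; rewrite mem_iota leq0n add0n -leqNgt; exact: F0.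
Qed.

(** * Exponentials of locally nilpotent operators on formal series *)

Section DistExp.
Variables (C : fieldType) (V : lmodType C).
Hypothesis C0 : forall n : nat, n.+1%:R != 0 :> C.
Implicit Types F G : int -> V.
Variables (X : (int -> V) -> int -> V) (L : (int -> V) -> Prop).

Definition lin_on (T : (int -> V) -> int -> V) :=
  forall (c : C) F G, L F -> L G -> T (c *: F + G) = c *: T F + T G.

(** The value of [T F] at k only sees [F] up to k + n. With the uniform nilpotency [X_nil], the
    exponential inside [T] can then be replaced by one finite truncation. *)
Definition local (T : (int -> V) -> int -> V) := exists n : nat, forall F G k,
  (forall k', k' <= k + n%:Z -> F k' = G k') -> T F k = T G k.

Hypothesis L0 : L 0.
Hypothesis L_lin : forall (c : C) F G, L F -> L G -> L (c *: F + G).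
Hypothesis XL : forall F, L F -> L (X F).
Hypothesis X_lin : lin_on X.
Hypothesis X_nil : forall F, L F -> forall k, exists N, forall m k',
  (N <= m)%N -> k' <= k -> iter m X F k' = 0.

Definition dexp F : int -> V :=
  fun k => \sum_(m \in [set: nat]) (m`!%:R)^-1 *: iter m X F k.

Definition dexp_trunc N F : int -> V :=
  \sum_(m < N) (m`!%:R)^-1 *: iter m X F.

Lemma L_scale c F : L F -> L (c *: F).
Proof. by move=> LF; rewrite -[_ *: _]addr0; exact: L_lin. Qed.

Lemma L_iter m F : L F -> L (iter m X F).
Proof. by move=> LF; elim: m => //= m; exact: XL. Qed.

Lemma L_sum N (c : nat -> C) (F : nat -> int -> V) :
  (forall m, L (F m)) -> L (\sum_(m < N) c m *: F m).
Proof.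
move=> LF; elim: N => [|N IH]; first by rewrite big_ord0.
by rewrite big_ord_recr /= addrC; exact: L_lin.
Qed.

Lemma lin_on0 T : lin_on T -> T 0 = 0.
Proof.
move=> Tl; have := Tl 1 0 0 L0 L0; rewrite !scale1r addr0 => h.
by apply: (addrI (T 0)); rewrite addr0 -h.
Qed.

Lemma lin_onZ T c F : lin_on T -> L F -> T (c *: F) = c *: T F.
Proof. by move=> Tl LF; rewrite -[c *: F]addr0 Tl // lin_on0 // addr0. Qed.

Lemma lin_onD T F G : lin_on T -> L F -> L G -> T (F + G) = T F + T G.
Proof. by move=> Tl LF LG; rewrite -[F]scale1r Tl // !scale1r. Qed.

Lemma lin_on_sum T N (c : nat -> C) (F : nat -> int -> V) :
  lin_on T -> (forall m, L (F m)) ->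
  T (\sum_(m < N) c m *: F m) = \sum_(m < N) c m *: T (F m).
Proof.
move=> Tl LF; elim: N => [|N IH]; first by rewrite !big_ord0 lin_on0.
rewrite !big_ord_recr /= addrC Tl //; last exact: L_sum.
by rewrite IH addrC.
Qed.

Lemma iter_lin m c F G : L F -> L G ->
  iter m X (c *: F + G) = c *: iter m X F + iter m X G.
Proof.
by move=> LF LG; elim: m => //= m ->; rewrite X_lin //; exact: L_iter.
Qed.

Lemma dexp_truncE N F k :
  (forall m, (N <= m)%N -> iter m X F k = 0) -> dexp F k = dexp_trunc N F k.
Proof.
move=> h; rewrite /dexp (fsum_nat (N := N)) => [|m /h ->]; last by rewrite scaler0.
by rewrite /dexp_trunc fct_sumE.
Qed.

Lemma dexp_lin c F G : L F -> L G -> dexp (c *: F + G) = c *: dexp F + dexp G.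
Proof.
move=> LF LG; apply/funext => k.
have [N hN] := X_nil LF k; have [N' hN'] := X_nil LG k.
pose K := maxn N N'.
have FK m : (K <= m)%N -> iter m X F k = 0.
  by rewrite geq_max => /andP[? _]; exact: hN.
have GK m : (K <= m)%N -> iter m X G k = 0.
  by rewrite geq_max => /andP[_ ?]; exact: hN'.
have lK m : iter m X (c *: F + G) k = c *: iter m X F k + iter m X G k.
  by rewrite iter_lin.
rewrite (dexp_truncE (N := K)); last first.
  by move=> m Km; rewrite lK FK // GK // scaler0 addr0.
change ((c *: dexp F + dexp G) k) with (c *: dexp F k + dexp G k).
rewrite (dexp_truncE FK) (dexp_truncE GK) /dexp_trunc !fct_sumE scaler_sumr.
rewrite -big_split; apply: eq_bigr => m _ /=.
change ((m`!%:R^-1 *: iter m X (c *: F + G)) k)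
  with (m`!%:R^-1 *: iter m X (c *: F + G) k).
by rewrite lK scalerDr !scalerA [c * _]mulrC.
Qed.

(** By induction X^m T = T X^m + m S X^(m-1), and m / m! = 1 / (m-1)! rebuilds the exponential next
    to S. The commutations below of exponentials with a_{-n}, with powers of z and with z d/dz are
    all instances. *)
Lemma dexp_comm T S F :
  (forall G, L G -> L (T G)) -> lin_on T -> local T ->
  (forall G, L G -> L (S G)) -> lin_on S -> local S ->
  (forall G, L G -> X (T G) = T (X G) + S G) ->
  (forall G, L G -> X (S G) = S (X G)) ->
  L F -> dexp (T F) = T (dexp F) + S (dexp F).
Proof.
move=> LT Tl [t Tt] LS Sl [s Ss] XT XS LF.
have iterS m : iter m X (S F) = S (iter m X F).
  by elim: m => //= m ->; rewrite XS //; exact: L_iter.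
have iterT m : iter m X (T F) = T (iter m X F) + m%:R *: S (iter m.-1 X F).
  elim: m => [|m IH] /=; first by rewrite scale0r addr0.
  rewrite IH lin_onD //; [|exact/LT/L_iter|exact/L_scale/LS/L_iter].
  rewrite lin_onZ //; last exact/LS/L_iter.
  rewrite XT ?XS; [|exact: L_iter|exact: L_iter].
  case: m {IH} => [|m] /=; first by rewrite scale0r addr0 scale1r.
  by rewrite -addrA; congr (_ + _); rewrite -{1}[S _]scale1r -scalerDl nat1r.
apply/funext => k.
have [N1 h1] := X_nil LF (k + t%:Z); have [N2 h2] := X_nil LF (k + s%:Z).
have [N3 h3] := X_nil (LT _ LF) k.
pose N := maxn N1 (maxn N2 N3).
have N1N : (N1 <= N)%N by rewrite leq_maxl.
have N2N : (N2 <= N)%N by rewrite /N; lia.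
have N3N : (N3 <= N)%N by rewrite /N; lia.
change ((T (dexp F) + S (dexp F)) k) with (T (dexp F) k + S (dexp F) k).
(* The correction term loses one power of X, so T takes N + 1 terms of the exponential where S takes
   N. *)
rewrite (Tt _ (dexp_trunc N.+1 F)); last first.
  move=> k' kk'; apply: dexp_truncE => m Nm; apply: h1 => //; lia.
rewrite (Ss _ (dexp_trunc N F)); last first.
  move=> k' kk'; apply: dexp_truncE => m Nm; apply: h2 => //; lia.
rewrite (dexp_truncE (N := N.+1)); last first.
  by move=> m Nm; apply: h3 => //; lia.
rewrite /dexp_trunc (@lin_on_sum _ _ (fun m => (m`!%:R)^-1)) //; last first.
  by move=> m; exact: L_iter.
rewrite (@lin_on_sum _ _ (fun m => (m`!%:R)^-1)) //; last by move=> m; exact: L_iter.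
set A := \sum_(m < N.+1) _ *: T _; set B := \sum_(m < N) _.
rewrite -[RHS]/((A + B) k) {}/A {}/B; congr (_ k).
under eq_bigr do rewrite iterT scalerDr.
rewrite big_split /=; congr (_ + _).
rewrite big_ord_recl /= scale0r scaler0 add0r; apply: eq_bigr => m _.
rewrite /bump /= add1n scalerA factS natrM invfM mulrC mulrA divff ?mul1r //.
Qed.

End DistExp.

Lemma sum_pred1_seq (V : nmodType) (I : eqType) (r : seq I) (i : I) (F : I -> V) :
  uniq r -> i \in r -> \sum_(j <- r | j == i) F j = F i.
Proof.
move=> ur ir; rewrite big_mkcond (bigD1_seq i) //= eqxx big1 ?addr0 // => j.
by move=> /negbTE ->.
Qed.

Section LinearMap.
Variables (C : fieldType) (V : lmodType C) (f : V -> V).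
Hypothesis f_lin : forall (c : C) u v, f (c *: u + v) = c *: f u + f v.

Lemma linf0 : f 0 = 0.
Proof. by have := f_lin (-1) 0 0; rewrite scaler0 addr0 scaleN1r addNr. Qed.

Lemma linfZ c u : f (c *: u) = c *: f u.
Proof. by rewrite -[c *: u]addr0 f_lin linf0 addr0. Qed.

Lemma linfD u v : f (u + v) = f u + f v.
Proof. by have := f_lin 1 u v; rewrite !scale1r. Qed.

Lemma linf_sum (I : Type) (r : seq I) (F : I -> V) :
  f (\sum_(i <- r) F i) = \sum_(i <- r) f (F i).
Proof. exact: (big_morph f linfD linf0). Qed.

End LinearMap.

(** * Creation words and the degree filtration *)

Section Fock.
Variables (C : fieldType) (M : fockSpace C).
Hypothesis C0 : forall n : nat, n.+1%:R != 0 :> C.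
Implicit Types (w : M) (n k j : int) (F G : int -> M).

Lemma cre_comm m n w : 0 < m -> 0 < n ->
  heis M (- m) (heis M (- n) w) = heis M (- n) (heis M (- m) w).
Proof.
move=> m0 n0; apply/eqP; rewrite -subr_eq0 heis_comm; [|lia|lia].
have -> : (- m == - - n) = false by lia.
by rewrite scale0r.
Qed.

Lemma ann_cre m n w : 0 < m -> 0 < n ->
  heis M m (heis M (- n) w) =
  heis M (- n) (heis M m w) + (if m == n then m%:~R else 0) *: w.
Proof.
move=> m0 n0; apply/eqP; rewrite addrC -subr_eq heis_comm; [|lia|lia].
by rewrite opprK.
Qed.

(* The span of the creation words applied to the vacuum is stable under the
   annihilation operators, so the creation operators alone generate. *)
Lemma vac_gen (P : M -> Prop) : P (vac M) ->
  (forall (c : C) (u v : M), P u -> P v -> P (c *: u + v)) ->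
  (forall n w, 0 < n -> P w -> P (heis M (- n) w)) ->
  forall w, P w.
Proof.
pose closed (Q : M -> Prop) := [/\ Q (vac M),
  forall (c : C) (u v : M), Q u -> Q v -> Q (c *: u + v) &
  forall n w, 0 < n -> Q w -> Q (heis M (- n) w)].
pose W w := forall Q, closed Q -> Q w.
have Wclosed : closed W.
  split=> [Q []//|c u v Wu Wv Q cQ|n w n0 Ww Q cQ]; case: (cQ) => Q0 Ql Qc.
    by apply: Ql; [exact: Wu|exact: Wv].
  by apply: Qc => //; exact: Ww.
have [W0 Wl Wc] := Wclosed.
have W00 : W 0 by have := Wl (-1) _ _ W0 W0; rewrite scaleN1r addNr.
have Wann n w : 0 < n -> W w -> W (heis M n w).
  move=> n0 Ww; pose Q v := W v /\ forall m, 0 < m -> W (heis M m v).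
  suff cQ : closed Q by have [_] := Ww Q cQ; exact.
  split.
  - by split=> // m m0; rewrite heis_vac.
  - move=> c u v [Wu au] [Wv av]; split; first exact: Wl.
    by move=> m m0; rewrite linearP; apply: Wl; [exact: au|exact: av].
  - move=> m v m0 [Wv av]; split; first exact: Wc.
    move=> p p0; rewrite ann_cre // addrC; apply: Wl => //.
    by apply: Wc => //; exact: av.
move=> P0 Pl Pc w; suff : W w by apply.
move: w; apply: vac_generates => // n w n0 Ww.
have [np|np] := ltP 0 n; first exact: Wann.
by rewrite -[n]opprK; apply: Wc => //; lia.
Qed.

(** The filtration by total degree, with a_{-n} in degree n. It is an inductive closure because a
    vector carries no chosen expression in creation words. Zero lies in every degree and is alone in
    the negative ones ([deg_le_neg]). *)
Inductive deg_le : int -> M -> Prop :=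
| deg_le0 d : deg_le d 0
| deg_le_lin d (c : C) u v : deg_le d u -> deg_le d v -> deg_le d (c *: u + v)
| deg_le_vac (d : int) : 0 <= d -> deg_le d (vac M)
| deg_le_cre (d n : int) w : 0 < n -> deg_le (d - n) w -> deg_le d (heis M (- n) w).

Lemma deg_le_mono d d' w : d <= d' -> deg_le d w -> deg_le d' w.
Proof.
move=> + H; elim: H d' => {d w}.
- by move=> *; exact: deg_le0.
- by move=> d c u v _ IHu _ IHv d' dd'; apply: deg_le_lin; [exact: IHu|exact: IHv].
- by move=> d d0 d' dd'; apply: deg_le_vac; lia.
- by move=> d n w n0 _ IH d' dd'; apply: deg_le_cre => //; apply: IH; lia.
Qed.

Lemma deg_le_neg d w : deg_le d w -> d < 0 -> w = 0.
Proof.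
elim=> {d w} //.
- by move=> d c u v _ IHu _ IHv d0; rewrite IHu // IHv // scaler0 addr0.
- by move=> d d0 d0'; move: d0 d0'; lia.
- by move=> d n w n0 _ IH d0; rewrite IH ?linear0 //; lia.
Qed.

Lemma deg_le_scale d (c : C) w : deg_le d w -> deg_le d (c *: w).
Proof. by move=> dw; rewrite -[_ *: _]addr0; apply: deg_le_lin => //; exact: deg_le0. Qed.

Lemma deg_le_ann d n w : 0 < n -> deg_le d w -> deg_le (d - n) (heis M n w).
Proof.
move=> n0; elim=> {d w}.
- by move=> d; rewrite linear0; exact: deg_le0.
- by move=> d c u v _ IHu _ IHv; rewrite linearP; exact: deg_le_lin.
- by move=> d d0; rewrite heis_vac //; exact: deg_le0.
- move=> d m w m0 dw IH; rewrite ann_cre // [X in deg_le _ X]addrC.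
  case: eqP => [nm|_]; last first.
    by rewrite scale0r add0r; apply: deg_le_cre => //; apply: deg_le_mono IH; lia.
  apply: deg_le_lin; first by rewrite nm.
  by apply: deg_le_cre => //; apply: deg_le_mono IH; lia.
Qed.

Lemma deg_le_sum d (I : Type) (r : seq I) (f : I -> M) :
  (forall i, deg_le d (f i)) -> deg_le d (\sum_(i <- r) f i).
Proof.
move=> df; elim: r => [|i r IH]; first by rewrite big_nil; exact: deg_le0.
by rewrite big_cons -[f i]scale1r; apply: deg_le_lin.
Qed.

Lemma deg_le_ex w : exists d, deg_le d w.
Proof.
move: w; apply: vac_gen.
- by exists 0; apply: deg_le_vac.
- move=> c u v [d du] [d' dv]; exists (`|d| + `|d'|).
  by apply: deg_le_lin; [apply: deg_le_mono du; lia|apply: deg_le_mono dv; lia].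
- by move=> n w n0 [d dw]; exists (d + n); apply: deg_le_cre; rewrite ?addrK.
Qed.

Definition cre_op n F : int -> M := fun k => heis M (- n) (F k).
(** Multiplication by c (z^n + t z^{-n}), the commutator of an annihilation exponent with a_{-n}: t
    = 1 for the vertex operators, t = 0 for [Gamma_+]. *)
Definition shift_op (c t : C) n F : int -> M :=
  fun k => c *: (F (k - n) + t *: F (k + n)).

Lemma local_cre n : local (cre_op n).
Proof. by exists 0%N => F G k FG; rewrite /cre_op FG //; lia. Qed.

Lemma local_shift c t n : local (shift_op c t n).
Proof. by exists `|n|%N => F G k FG; rewrite /shift_op !FG //; lia. Qed.

Lemma lin_cre L n : lin_on L (cre_op n).
Proof. by move=> c F G _ _; apply/funext => k; rewrite /cre_op linearP. Qed.

Lemma lin_shift L c t n : lin_on L (shift_op c t n).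
Proof.
move=> b F G _ _; apply/funext => k; rewrite /shift_op.
rewrite -[RHS]/(b *: (c *: (F (k - n) + t *: F (k + n))) +
  c *: (G (k - n) + t *: G (k + n))).
rewrite -[(b *: F + G) (k - n)]/(b *: F (k - n) + G (k - n)).
rewrite -[(b *: F + G) (k + n)]/(b *: F (k + n) + G (k + n)).
by lmod_ring.
Qed.

(** [La] is the class for annihilation exponents: powers of z are paid for by degree, which forces
    finite support. Creation exponents raise the degree, and there [Lc], a lower bound on the powers
    of z, suffices. *)
Definition La F := exists d, forall k, deg_le (d - `|k|) (F k).
Definition Lc F := exists d, forall k, k < d -> F k = 0.

Lemma La0 : La 0.
Proof. by exists 0 => k; exact: deg_le0. Qed.

Lemma Lc0 : Lc 0.
Proof. by exists 0. Qed.

Lemma La_lin c F G : La F -> La G -> La (c *: F + G).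
Proof.
move=> [d dF] [d' dG]; exists (`|d| + `|d'|) => k; apply: deg_le_lin.
  by apply: deg_le_mono (dF k); lia.
by apply: deg_le_mono (dG k); lia.
Qed.

Lemma Lc_lin c F G : Lc F -> Lc G -> Lc (c *: F + G).
Proof.
move=> [d dF] [d' dG]; exists (- (`|d| + `|d'|)) => k kd.
rewrite -[LHS]/(c *: F k + G k) dF ?dG ?scaler0 ?addr0 //; lia.
Qed.

Lemma La_const w : La (dist_const w).
Proof.
have [d dw] := deg_le_ex w; exists d => k; rewrite /dist_const.
by case: eqP => [->|_]; [rewrite normr0 subr0|exact: deg_le0].
Qed.

Lemma Lc_const w : Lc (dist_const w).
Proof. by exists 0 => k k0; rewrite /dist_const ifF //; lia. Qed.

Lemma La_cre n F : 0 < n -> La F -> La (cre_op n F).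
Proof.
move=> n0 [d dF]; exists (d + n) => k; apply: deg_le_cre => //.
by apply: deg_le_mono (dF k); lia.
Qed.

Lemma Lc_cre n F : Lc F -> Lc (cre_op n F).
Proof. by move=> [d dF]; exists d => k kd; rewrite /cre_op dF // linear0. Qed.

Lemma La_shift c t n F : La F -> La (shift_op c t n F).
Proof.
move=> [d dF]; exists (d + `|n|) => k; apply: deg_le_scale.
rewrite -[X in deg_le _ (X + _)]scale1r; apply: deg_le_lin.
  by apply: deg_le_mono (dF _); lia.
by apply: deg_le_scale; apply: deg_le_mono (dF _); lia.
Qed.

Lemma Lc_shift c t n F : Lc F -> Lc (shift_op c t n F).
Proof.
move=> [d dF]; exists (d - `|n|) => k kd.
by rewrite /shift_op !dF ?scaler0 ?addr0 ?scaler0 //; lia.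
Qed.

Lemma dist_const_cre n w : dist_const (heis M (- n) w) = cre_op n (dist_const w).
Proof.
by apply/funext => k; rewrite /cre_op /dist_const; case: eqP; rewrite ?linear0.
Qed.

Lemma dist_const_lin (c : C) u v :
  dist_const (c *: u + v : M) = c *: dist_const u + dist_const v.
Proof.
apply/funext => k; rewrite -[RHS]/(c *: dist_const u k + dist_const v k).
by rewrite /dist_const; case: eqP; rewrite // scaler0 addr0.
Qed.

(** * Exponentials of annihilation families *)

Section AnnihilationExponential.
Variables (A : int -> M -> M) (g t : C).
Hypothesis A_lin : forall j (c : C) u v, A j (c *: u + v) = c *: A j u + A j v.
Hypothesis A_0 : forall w, A 0 w = 0.
Hypothesis A_deg_le : forall j d w, deg_le d w -> deg_le (d - `|j|) (A j w).
Hypothesis A_cre : forall j n w, 0 < n -> A j (heis M (- n) w) =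
  heis M (- n) (A j w) + (if j == n then g else if j == - n then g * t else 0) *: w.
Hypothesis A_vac : forall j, A j (vac M) = 0.

Let X := dist_act A.

Let A0 j : A j 0 = 0.
Proof. exact: linf0. Qed.

Lemma ann_fin_supp F k : La F -> fin_supp (fun j => A j (F (k - j))).
Proof.
move=> [d dF]; apply/fin_suppP.
exists [seq i%:Z - `|d| | i <- iota 0 (`|d| + `|d| + 1)%N] => j jd.
apply: (@deg_le_neg (d - `|k - j| - `|j|)); first by apply: A_deg_le.
suff : `|d| < `|j| by lia.
rewrite ltNge; apply: contra jd => jd; apply/mapP.
by exists (absz (j + `|d|)); rewrite ?mem_iota; lia.
Qed.

Lemma ann_XL F : La F -> La (X F).
Proof.
move=> LF; have [d dF] := LF; exists d => k.
have /fin_suppP[r rP] := ann_fin_supp k LF.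
rewrite /X /dist_act (fsumT_seq rP); apply: deg_le_sum => j.
by apply: deg_le_mono (A_deg_le j (dF (k - j))); lia.
Qed.

Lemma ann_X_lin : lin_on La X.
Proof.
move=> c F G LF LG; apply/funext => k.
have Lf := ann_fin_supp k LF; have Lg := ann_fin_supp k LG.
rewrite -[RHS]/(c *: X F k + X G k) /X /dist_act.
have [r rP] := fin_supp_seq2 Lf Lg.
rewrite !(@fsumT_seq _ _ r).
- by rewrite scaler_sumr -big_split; apply: eq_bigr => j _ /=; rewrite A_lin.
- by move=> j /rP[].
- by move=> j /rP[].
- move=> j /rP[Fj Gj].
  rewrite -[(c *: F + G) _]/(c *: F (k - j) + G (k - j)) A_lin Fj Gj.
  by rewrite scaler0 addr0.
Qed.

(** There is no zero mode, so each application of the exponent lowers the degree by at least one, at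
    every power of z at once. *)
Lemma ann_X_nil F : La F -> forall k, exists N, forall m k',
  (N <= m)%N -> k' <= k -> iter m X F k' = 0.
Proof.
move=> LF k; have [d dF] := LF.
suff H m k' : deg_le (d - m%:Z) (iter m X F k').
  by exists `|d|.+1%N => m k' dm _; apply: deg_le_neg (H m k') _; lia.
elim: m k' => [|m IH] k' /=; first by apply: deg_le_mono (dF k'); lia.
have /fin_suppP[r rP] : fin_supp (fun j => A j (iter m X F (k' - j))).
  by apply: ann_fin_supp; elim: (m) => //= p; exact: ann_XL.
rewrite /X /dist_act (fsumT_seq rP); apply: deg_le_sum => j.
have [->|j0] := eqVneq j 0; first by rewrite A_0; exact: deg_le0.
by apply: deg_le_mono (A_deg_le j (IH _)); lia.
Qed.

Lemma ann_X_cre n F : 0 < n -> La F ->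
  X (cre_op n F) = cre_op n (X F) + shift_op g t n F.
Proof.
move=> n0 LF; apply/funext => k.
rewrite -[RHS]/(cre_op n (X F) k + shift_op g t n F k) /X /dist_act /cre_op /=.
have /fin_suppP[r rP] := ann_fin_supp k LF.
(* The commutator sits at the modes n and - n, which the support [r] of the original sum may
   miss. *)
pose s := [:: n; - n] ++ r.
have rs i : i \notin s -> i \notin r by rewrite mem_cat negb_or => /andP[].
have ns i : i \notin s -> (i == n = false) * (i == - n = false).
  by rewrite /s !inE !negb_or => /and3P[/negbTE ? /negbTE ?].
rewrite !(@fsumT_seq _ _ s).
- under eq_bigr do rewrite A_cre //.
  rewrite big_split linear_sum /=; congr (_ + _).
  have -> : \sum_(j <- undup s)
      (if j == n then g else if j == - n then g * t else 0) *: F (k - j) =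
    \sum_(j <- undup s | j == n) g *: F (k - j) +
    \sum_(j <- undup s | j == - n) (g * t) *: F (k - j).
    rewrite [X in X + _]big_mkcond [X in _ + X]big_mkcond -big_split /=.
    apply: eq_bigr => j _; have [->|_] := eqVneq j n.
      by rewrite ifF ?addr0 //; lia.
    by case: eqP => _; rewrite ?scale0r add0r.
  rewrite !sum_pred1_seq ?undup_uniq ?mem_undup ?mem_cat ?inE ?eqxx ?orbT //.
  by rewrite opprK /shift_op; lmod_ring.
- by move=> j /rs/rP.
- move=> j js; rewrite A_cre // rP ?linear0 ?add0r ?ns ?scale0r //; exact: rs.
Qed.

Lemma ann_X_shift n F : La F -> X (shift_op g t n F) = shift_op g t n (X F).
Proof.
move=> LF; apply/funext => k; rewrite /X /dist_act /shift_op /=.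
have [r rP] := fin_supp_seq2 (ann_fin_supp (k - n) LF) (ann_fin_supp (k + n) LF).
have Ash j : A j (g *: (F (k - j - n) + t *: F (k - j + n))) =
    g *: (A j (F (k - n - j)) + t *: A j (F (k + n - j))).
  rewrite (linfZ (A_lin j)) (linfD (A_lin j)) (linfZ (A_lin j)).
  by congr (_ *: (A j (F _) + _ *: A j (F _))); lia.
rewrite !(@fsumT_seq _ _ r).
- under eq_bigr do rewrite Ash.
  by rewrite -scaler_sumr big_split -scaler_sumr.
- by move=> j /rP[].
- by move=> j /rP[].
- by move=> j /rP[Fj Gj]; rewrite Ash Fj Gj scaler0 addr0 scaler0.
Qed.

Lemma ann_exp_cre n F : 0 < n -> La F -> dist_exp A (cre_op n F) =
  cre_op n (dist_exp A F) + shift_op g t n (dist_exp A F).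
Proof.
move=> n0 LF; apply: (dexp_comm C0 La0 La_lin ann_XL ann_X_lin ann_X_nil _ _ _ _ _ _ _ _ LF).
- by move=> G; exact: La_cre.
- exact: lin_cre.
- exact: local_cre.
- by move=> G; exact: La_shift.
- exact: lin_shift.
- exact: local_shift.
- by move=> G; exact: ann_X_cre.
- by move=> G; exact: ann_X_shift.
Qed.

Lemma ann_exp_lin c F G : La F -> La G ->
  dist_exp A (c *: F + G) = c *: dist_exp A F + dist_exp A G.
Proof. exact: (dexp_lin ann_XL ann_X_lin ann_X_nil). Qed.

Lemma ann_exp_vac : dist_exp A (dist_const (vac M)) = dist_const (vac M).
Proof.
have X0 : X (dist_const (vac M)) = 0.
  apply/funext => k; rewrite /X /dist_act fsbig1 // => j _.
  by rewrite /dist_const; case: eqP => _; [exact: A_vac|exact: A0].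
apply/funext => k; rewrite -[LHS]/(dexp X (dist_const (vac M)) k).
rewrite (dexp_truncE (N := 1)).
  by rewrite /dexp_trunc big_ord1 invr1 scale1r.
case=> // m _; elim: m k => [|m IH] k; first by rewrite /= X0.
by rewrite iterS /X /dist_act fsbig1 // => j _; rewrite IH.
Qed.

(** All iterates keep degree at most d - |k| at z^k, so nothing is left for |k| > |d|. This makes
    the result a legal input of the creation exponential. *)
Lemma ann_exp_Lc F : La F -> Lc (dist_exp A F).
Proof.
move=> [d dF]; exists (- (`|d| + 1)) => k kd.
rewrite /dist_exp fsbig1 // => m _.
have : La (iter m X F) by elim: m => [|m IH] /=; [exists d|exact: ann_XL].
suff H : forall k, deg_le (d - `|k|) (iter m X F k).
  by move=> _; rewrite (deg_le_neg (H k)) ?scaler0 //; lia.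
elim: m => [|m IH] // k'.
have /fin_suppP[r rP] : fin_supp (fun j => A j (iter m X F (k' - j))).
  by apply: ann_fin_supp; exists d.
rewrite iterS /X /dist_act (fsumT_seq rP); apply: deg_le_sum => j.
by apply: deg_le_mono (A_deg_le j (IH _)); lia.
Qed.

End AnnihilationExponential.

(** * Exponentials of creation families *)

Section CreationExponential.
Variables (s : C).

Definition scre j w := s *: heis_cre j w.
(* The family of z d/dz applied to the exponent. *)
Definition dscre j w := if 0 < j then s *: heis M (- j) w else 0.

Let X := dist_act scre.

Lemma scre_lin j c u v : scre j (c *: u + v) = c *: scre j u + scre j v.
Proof.
rewrite /scre /heis_cre; case: ifP => _; last by rewrite !scaler0 addr0.
by rewrite linearP; lmod_ring.
Qed.

Lemma dscre_lin j c u v : dscre j (c *: u + v) = c *: dscre j u + dscre j v.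
Proof.
rewrite /dscre; case: ifP => _; last by rewrite !scaler0 addr0.
by rewrite linearP; lmod_ring.
Qed.

Section PositiveFamily.
Variable B : int -> M -> M.
Hypothesis B_lin : forall j (c : C) u v, B j (c *: u + v) = c *: B j u + B j v.
Hypothesis B_pos : forall j w, j <= 0 -> B j w = 0.

(** The length [N] is free above k - d so that several series can be summed over one common range
    and compared term by term. *)
Lemma pos_act_sum F d k (N : nat) : (forall k, k < d -> F k = 0) ->
  k - d <= N%:Z -> dist_act B F k = \sum_(i < N) B i.+1%:Z (F (k - i.+1%:Z)).
Proof.
move=> Fd kN; have B0 j : B j 0 = 0 by exact: linf0.
rewrite /dist_act (@fsumT_seq _ _ [seq i.+1%:Z | i <- iota 0 N]).
  rewrite undup_id ?map_inj_uniq ?iota_uniq //; last by move=> i j; lia.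
  by rewrite big_map -(big_mkord xpredT (fun i => B i.+1%:Z (F (k - i.+1%:Z))))
    /index_iota subn0.
move=> j jN; have [j0|j0] := leP j 0; first exact: B_pos.
rewrite Fd ?B0 // ltNge; apply: contra jN => jd; apply/mapP.
by exists (absz (j - 1)); rewrite ?mem_iota; lia.
Qed.

Lemma pos_Lc F : Lc F -> Lc (dist_act B F).
Proof.
move=> [d dF]; exists d => k kd; rewrite (@pos_act_sum _ d _ 0%N) ?big_ord0 //; lia.
Qed.

Lemma pos_lin : lin_on Lc (dist_act B).
Proof.
move=> c F G [d dF] [d' dG]; apply/funext => k.
rewrite -[RHS]/(c *: dist_act B F k + dist_act B G k).
pose e := - (`|d| + `|d'|); pose N := absz (k - e).
rewrite (@pos_act_sum F e _ N); [|by move=> i ie; apply: dF; rewrite /e in ie; lia|lia].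
rewrite (@pos_act_sum G e _ N); [|by move=> i ie; apply: dG; rewrite /e in ie; lia|lia].
rewrite (@pos_act_sum _ e _ N); [| |lia]; last first.
  move=> i ie; rewrite -[LHS]/(c *: F i + G i) dF ?dG ?scaler0 ?addr0 //.
    by rewrite /e in ie; lia.
  by rewrite /e in ie; lia.
rewrite scaler_sumr -big_split; apply: eq_bigr => i _ /=; exact: B_lin.
Qed.

Lemma pos_local : local (dist_act B).
Proof.
exists 0%N => F G k FG; apply: eq_fsbigr => j _.
by have [j0|j0] := leP j 0; [rewrite !B_pos|rewrite FG //; lia].
Qed.

Lemma pos_cre n F :
  (forall j w, B j (heis M (- n) w) = heis M (- n) (B j w)) ->
  Lc F -> dist_act B (cre_op n F) = cre_op n (dist_act B F).
Proof.
move=> Bn [d dF]; apply/funext => k; rewrite /cre_op.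
rewrite (@pos_act_sum F d _ (absz (k - d))) //; last lia.
rewrite (@pos_act_sum _ d _ (absz (k - d))); [| |lia].
  by rewrite linear_sum; apply: eq_bigr => i _; rewrite Bn.
by move=> i id; rewrite dF ?linear0.
Qed.

Lemma pos_shift c t n F : Lc F ->
  dist_act B (shift_op c t n F) = shift_op c t n (dist_act B F).
Proof.
move=> [d dF]; apply/funext => k; rewrite /shift_op.
have B0 j : B j 0 = 0 by exact: linf0.
pose e := d - `|n|; pose N := absz (`|k| + `|n| + `|e|).
rewrite !(@pos_act_sum F e _ N) //; try (by move=> i ie; apply: dF; rewrite /e in ie; lia);
  try lia.
rewrite (@pos_act_sum _ e _ N) //; [| |lia]; last first.
  by move=> i ie; rewrite /e in ie; rewrite !dF ?scaler0 ?addr0 ?scaler0 //; lia.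
rewrite scaler_sumr -big_split scaler_sumr; apply: eq_bigr => i _ /=.
have Bl a b u v : B i.+1 (a *: (u + b *: v)) = a *: (B i.+1 u + b *: B i.+1 v).
  by rewrite (linfZ (B_lin _)) (linfD (B_lin _)) (linfZ (B_lin _)).
rewrite Bl; congr (_ *: (B _ (F _) + _ *: B _ (F _))); lia.
Qed.

End PositiveFamily.

Lemma scre_pos j w : j <= 0 -> scre j w = 0.
Proof. by move=> j0; rewrite /scre /heis_cre ltNge j0 scaler0. Qed.

Lemma dscre_pos j w : j <= 0 -> dscre j w = 0.
Proof. by move=> j0; rewrite /dscre ltNge j0. Qed.

Lemma scre_cre j n w : 0 < n -> scre j (heis M (- n) w) = heis M (- n) (scre j w).
Proof.
move=> n0; rewrite /scre /heis_cre; case: ifP => j0; last by rewrite !scaler0 linear0.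
by rewrite !linearZ /= cre_comm // !scalerA mulrC.
Qed.

Lemma int_neq0 j : j != 0 -> j%:~R != 0 :> C.
Proof.
case: j => [[|n]|n] // _; first by rewrite -pmulrn; exact: C0.
by rewrite NegzE mulrNz oppr_eq0; exact: C0.
Qed.

Lemma dscreE j w : dscre j w = j%:~R *: scre j w.
Proof.
rewrite /scre /dscre /heis_cre; case: ifP => j0; last by rewrite !scaler0.
by rewrite !scalerA mulrAC divff ?mul1r //; apply: int_neq0; lia.
Qed.

Lemma scre_dscre i j w : scre i (dscre j w) = dscre j (scre i w).
Proof.
rewrite /dscre; case: ifP => j0; last exact: (linf0 (scre_lin i)).
by rewrite (linfZ (scre_lin i)) scre_cre.
Qed.

(** Only positive powers of z occur, so each application moves the lowest power up by one; this is
    the local nilpotency of creation exponents. *)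
Lemma scre_iter_Lc F m d : (forall k, k < d -> F k = 0) ->
  forall k, k < d + m%:Z -> iter m X F k = 0.
Proof.
move=> dF; elim: m => [|m IH] k kd /=; first by apply: dF; lia.
rewrite /X (@pos_act_sum _ scre_lin scre_pos _ (d + m%:Z) _ 0%N) ?big_ord0 //.
lia.
Qed.

Lemma scre_nil F : Lc F -> forall k, exists N, forall m k',
  (N <= m)%N -> k' <= k -> iter m X F k' = 0.
Proof.
move=> [d dF] k; exists (absz (k - d)).+1 => m k' Nm k'k.
by apply: (scre_iter_Lc dF); lia.
Qed.

Let XL := pos_Lc scre_lin scre_pos.
Let Xlin := pos_lin scre_lin scre_pos.

Lemma lin_zero L : lin_on L (fun=> 0 : int -> M).
Proof. by move=> c F G _ _; rewrite scaler0 addr0. Qed.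

Lemma local_zero : local (fun=> 0 : int -> M).
Proof. by exists 0%N. Qed.

Lemma scre_exp_lin c F G : Lc F -> Lc G ->
  dist_exp scre (c *: F + G) = c *: dist_exp scre F + dist_exp scre G.
Proof. exact: (dexp_lin XL Xlin scre_nil). Qed.

Lemma scre_exp_cre n F : 0 < n -> Lc F ->
  dist_exp scre (cre_op n F) = cre_op n (dist_exp scre F).
Proof.
(* The operators commute: [dexp_comm] with correction term zero. *)
move=> n0 LF; rewrite -[RHS]addr0.
apply: (@dexp_comm _ _ C0 _ _ Lc0 Lc_lin XL Xlin scre_nil _ (fun=> 0) F _ _ _ _ _ _ _ _ LF).
- by move=> G; exact: Lc_cre.
- exact: lin_cre.
- exact: local_cre.
- by move=> *; exact: Lc0.
- exact: lin_zero.
- exact: local_zero.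
- by move=> G LG; rewrite addr0; apply: (pos_cre scre_lin scre_pos) => // *; exact: scre_cre.
- by move=> G LG; apply: (lin_on0 Lc0 Xlin).
Qed.

Lemma scre_exp_shift c t n F : Lc F ->
  dist_exp scre (shift_op c t n F) = shift_op c t n (dist_exp scre F).
Proof.
move=> LF; rewrite -[RHS]addr0.
apply: (@dexp_comm _ _ C0 _ _ Lc0 Lc_lin XL Xlin scre_nil _ (fun=> 0) F _ _ _ _ _ _ _ _ LF).
- by move=> G; exact: Lc_shift.
- exact: lin_shift.
- exact: local_shift.
- by move=> *; exact: Lc0.
- exact: lin_zero.
- exact: local_zero.
- by move=> G LG; rewrite addr0; apply: (pos_shift scre_lin scre_pos).
- by move=> G LG; apply: (lin_on0 Lc0 Xlin).
Qed.

Lemma scre_exp_neg F d k : (forall k, k < d -> F k = 0) -> k < d ->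
  dist_exp scre F k = 0.
Proof.
move=> dF kd; rewrite /dist_exp fsbig1 // => m _.
by rewrite (scre_iter_Lc dF) ?scaler0 //; lia.
Qed.

Definition euler_op F : int -> M := fun k => k%:~R *: F k.

(** This is [dexp_comm] for z d/dz: its commutator with the exponent is minus the derivative of the
    exponent, and creation operators commute, so the chain rule for exp keeps its scalar form. *)
Lemma scre_exp_euler F : Lc F -> dist_exp scre (euler_op F) =
  euler_op (dist_exp scre F) - dist_act dscre (dist_exp scre F).
Proof.
move=> LF; pose D := dist_act dscre.
have Lopp G : Lc G -> Lc (- G).
  by move=> LG; rewrite -scaleN1r -[_ *: _]addr0; apply: Lc_lin => //; exact: Lc0.
have Dl := pos_lin dscre_lin dscre_pos.
have LD := pos_Lc dscre_lin dscre_pos.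
apply: (@dexp_comm _ _ C0 _ _ Lc0 Lc_lin XL Xlin scre_nil euler_op
  (fun G => - D G) F _ _ _ _ _ _ _ _ LF).
- move=> G [d dG]; exists d => k kd; rewrite /euler_op dG ?scaler0 //.
- move=> c G H _ _; apply/funext => k; rewrite /euler_op.
  rewrite -[(c *: G + H) k]/(c *: G k + H k).
  rewrite -[RHS]/(c *: (k%:~R *: G k) + k%:~R *: H k).
  by lmod_ring.
- by exists 0%N => G H k GH; rewrite /euler_op GH //; lia.
- by move=> G LG; apply: Lopp; apply: LD.
- by move=> c G H LG LH; rewrite /D Dl // opprD scalerN.
- have [n Dn] := pos_local dscre_pos.
  by exists n => G H k GH; rewrite -[LHS]/(- D G k) -[RHS]/(- D H k) /D (Dn _ H).
- move=> G [d dG]; apply/funext => k.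
  rewrite -[RHS]/(k%:~R *: X G k - D G k) /D /X.
  rewrite !(@pos_act_sum _ scre_lin scre_pos _ d _ (absz (k - d))) //; try lia; last first.
    by move=> i id; rewrite /euler_op dG ?scaler0.
  rewrite (@pos_act_sum _ dscre_lin dscre_pos _ d _ (absz (k - d))) //; last lia.
  rewrite scaler_sumr -sumrB; apply: eq_bigr => i _.
  by rewrite /euler_op (linfZ (scre_lin _)) dscreE rmorphB; lmod_ring.
- move=> G [d dG]; have LG : Lc G by exists d.
  rewrite -[LHS]/(X (- D G)) -[RHS]/(- D (X G)).
  have -> : X (- D G) = - X (D G).
    by rewrite -!scaleN1r; apply: (lin_onZ Lc0 _ Xlin); apply: LD.
  congr (- _); apply/funext => k; rewrite /X /D; set N := absz (k - d).
  have LDd : forall i, i < d -> dist_act dscre G i = 0.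
    move=> i id; rewrite (@pos_act_sum _ dscre_lin dscre_pos _ d _ 0%N) ?big_ord0 //; lia.
  have LXd : forall i, i < d -> dist_act scre G i = 0.
    move=> i id; rewrite (@pos_act_sum _ scre_lin scre_pos _ d _ 0%N) ?big_ord0 //; lia.
  rewrite (@pos_act_sum _ scre_lin scre_pos _ d _ N) //; last lia.
  rewrite (@pos_act_sum _ dscre_lin dscre_pos _ d _ N) //; last lia.
  under eq_bigr => i _.
    rewrite (@pos_act_sum _ dscre_lin dscre_pos _ d _ N) //; last lia.
    rewrite (linf_sum (scre_lin _)); over.
  under [RHS]eq_bigr => i _.
    rewrite (@pos_act_sum _ scre_lin scre_pos _ d _ N) //; last lia.
    rewrite (linf_sum (dscre_lin _)); over.
  rewrite exchange_big /=; apply: eq_bigr => i _; apply: eq_bigr => j _.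
  by rewrite scre_dscre; congr (dscre _ (scre _ (G _))); lia.
Qed.

End CreationExponential.
End Fock.

(** * Modes of the vertex operators and of [Gamma_+] *)

Section VertexModes.
Variables (C : fieldType) (M : fockSpace C).
Hypothesis C0 : forall n : nat, n.+1%:R != 0 :> C.
Implicit Types (w : M) (n k j : int) (s : C).

Lemma heis_ann_lin j (c : C) (u v : M) :
  heis_ann j (c *: u + v) = c *: heis_ann j u + heis_ann j v.
Proof.
rewrite /heis_ann; case: ifP => _; last by rewrite scaler0 addr0.
by rewrite linearP; lmod_ring.
Qed.

Lemma heis_ann_cre j n w : 0 < n -> heis_ann j (heis M (- n) w) =
  heis M (- n) (heis_ann j w) + (if j == n then 1 else 0) *: w.
Proof.
move=> n0; rewrite /heis_ann; case: ifP => j0; last first.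
  by rewrite linear0 ifF ?scale0r ?addr0 //; lia.
rewrite ann_cre // linearZ /= scalerDr; congr (_ + _); rewrite scalerA.
case: ifP => _; last by rewrite mulr0.
by rewrite mulVf //; apply: int_neq0 => //; lia.
Qed.

Lemma heis_ann0 w : heis_ann 0 w = 0.
Proof. by []. Qed.

Lemma heis_ann_vac j : heis_ann j (vac M) = 0.
Proof. by rewrite /heis_ann; case: ifP => // j0; rewrite heis_vac ?scaler0. Qed.

Lemma heis_ann_deg_le j (d : int) w : deg_le d w -> deg_le (d - `|j|) (heis_ann j w).
Proof.
move=> dw; rewrite /heis_ann; case: ifP => j0; last exact: deg_le0.
by apply: deg_le_scale; apply: deg_le_mono (deg_le_ann j0 dw); lia.
Qed.

Definition sym_fam (c : C) j w := c *: heis_ann_sym j w.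

Lemma sym_lin c0 j (c : C) (u v : M) :
  sym_fam c0 j (c *: u + v) = c *: sym_fam c0 j u + sym_fam c0 j v.
Proof. by rewrite /sym_fam /heis_ann_sym !heis_ann_lin; lmod_ring. Qed.

Lemma sym0 c w : sym_fam c 0 w = 0.
Proof. by rewrite /sym_fam /heis_ann_sym oppr0 heis_ann0 addr0 scaler0. Qed.

Lemma sym_deg_le c j (d : int) w : deg_le d w -> deg_le (d - `|j|) (sym_fam c j w).
Proof.
move=> dw; apply: deg_le_scale; rewrite /heis_ann_sym -[heis_ann j w]scale1r.
apply: deg_le_lin; first exact: heis_ann_deg_le.
by have := heis_ann_deg_le (- j) dw; rewrite normrN.
Qed.

Lemma sym_cre c j n w : 0 < n -> sym_fam c j (heis M (- n) w) =
  heis M (- n) (sym_fam c j w) +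
  (if j == n then c else if j == - n then c * 1 else 0) *: w.
Proof.
move=> n0; rewrite /sym_fam /heis_ann_sym !heis_ann_cre // linearZ linearD /=.
have -> : (- j == n) = (j == - n) by lia.
have [jn|_] := eqVneq j n; last by case: ifP => _; lmod_ring.
by rewrite ifF; [lmod_ring|lia].
Qed.

Lemma sym_vac c j : sym_fam c j (vac M) = 0.
Proof. by rewrite /sym_fam /heis_ann_sym !heis_ann_vac addr0 scaler0. Qed.

Lemma ann_cre_t0 j n w : 0 < n -> heis_ann j (heis M (- n) w) =
  heis M (- n) (heis_ann j w) +
  (if j == n then 1 else if j == - n then 1 * 0 else 0 : C) *: w.
Proof. by move=> n0; rewrite heis_ann_cre // mulr0; case: (j == - n). Qed.

Definition gmode k w := dist_exp (@heis_ann C M) (dist_const w) k.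
(** The sign [s] treats U at s = 1 and U* at s = -1 together, prefactors left out. On the vacuum
    only the creation half [emode] remains. *)
Definition vmode s k w := dist_exp (scre s) (dist_exp (sym_fam (- s)) (dist_const w)) k.
Definition emode s k w := dist_exp (scre s) (dist_const w) k.

Lemma U_coreE w k : U_core w k = vmode 1 k w.
Proof.
have cre1 : scre 1 = @heis_cre C M.
  by apply/funext => j; apply/funext => v; rewrite /scre scale1r.
have symN : sym_fam (- 1) = dist_opp (@heis_ann_sym C M).
  by apply/funext => j; apply/funext => v; rewrite /sym_fam /dist_opp scaleN1r.
by rewrite /vmode cre1 symN.
Qed.

Lemma Ustar_coreE w k : Ustar_core w k = vmode (-1) k w.
Proof.
have creN : scre (-1) = dist_opp (@heis_cre C M).
  by apply/funext => j; apply/funext => v; rewrite /scre /dist_opp scaleN1r.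
have sym1 : sym_fam (- -1) = @heis_ann_sym C M.
  by apply/funext => j; apply/funext => v; rewrite /sym_fam opprK scale1r.
by rewrite /vmode creN sym1.
Qed.

Lemma gmode_lin k (c : C) (u v : M) :
  gmode k (c *: u + v) = c *: gmode k u + gmode k v.
Proof.
rewrite /gmode dist_const_lin (ann_exp_lin heis_ann_lin heis_ann0 heis_ann_deg_le) //;
  exact: La_const.
Qed.

Lemma gmode_cre k n w : 0 < n ->
  gmode k (heis M (- n) w) = heis M (- n) (gmode k w) + gmode (k - n) w.
Proof.
move=> n0; rewrite /gmode dist_const_cre.
rewrite (ann_exp_cre C0 heis_ann_lin heis_ann0 heis_ann_deg_le ann_cre_t0 n0);
  last exact: La_const.
by rewrite -[LHS]/(cre_op n _ k + shift_op 1 0 n _ k) /cre_op /shift_op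
  scale0r addr0 scale1r.
Qed.

Lemma gmode_vac k : gmode k (vac M) = dist_const (vac M) k.
Proof. by rewrite /gmode (ann_exp_vac heis_ann_lin heis_ann_vac). Qed.

Lemma gmode_neg k w : k < 0 -> gmode k w = 0.
Proof.
move: w k; apply: vac_gen.
- by move=> k k0; rewrite gmode_vac /dist_const ifF //; lia.
- by move=> c u v Hu Hv k k0; rewrite gmode_lin Hu // Hv // scaler0 addr0.
- move=> n w n0 Hw k k0; rewrite gmode_cre // !Hw ?linear0 ?addr0 //; lia.
Qed.

Lemma vmode_lin s k (c : C) (u v : M) :
  vmode s k (c *: u + v) = c *: vmode s k u + vmode s k v.
Proof.
rewrite /vmode dist_const_lin (ann_exp_lin (sym_lin _) (sym0 _) (@sym_deg_le _));
  [|exact: La_const|exact: La_const].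
by rewrite scre_exp_lin //; apply: (ann_exp_Lc (@sym_deg_le _));
  exact: La_const.
Qed.

Lemma vmode_cre s k n w : 0 < n -> vmode s k (heis M (- n) w) =
  heis M (- n) (vmode s k w) - s *: (vmode s (k - n) w + vmode s (k + n) w).
Proof.
move=> n0; rewrite /vmode dist_const_cre.
rewrite (ann_exp_cre C0 (sym_lin _) (sym0 _) (@sym_deg_le _) (sym_cre _) n0);
  last exact: La_const.
set F := dist_exp _ (dist_const w).
have LF : Lc F by apply: (ann_exp_Lc (@sym_deg_le _)); exact: La_const.
rewrite -[cre_op _ _]scale1r scre_exp_lin //; last 2 first.
- exact: Lc_cre.
- exact: Lc_shift.
rewrite scale1r (scre_exp_cre C0 s n0 LF) (scre_exp_shift C0) //.
by rewrite -[LHS]/(cre_op n _ k + shift_op _ _ n _ k) /cre_op /shift_op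
  scale1r scaleNr.
Qed.

Lemma vmode_vac s k : vmode s k (vac M) = emode s k (vac M).
Proof. by rewrite /vmode (ann_exp_vac (sym_lin _) (sym_vac _)). Qed.

Lemma emode_lin s k (c : C) (u v : M) :
  emode s k (c *: u + v) = c *: emode s k u + emode s k v.
Proof. by rewrite /emode dist_const_lin scre_exp_lin //; exact: Lc_const. Qed.

Lemma emode_cre s k n w : 0 < n ->
  emode s k (heis M (- n) w) = heis M (- n) (emode s k w).
Proof.
by move=> n0; rewrite /emode dist_const_cre scre_exp_cre //; exact: Lc_const.
Qed.

Lemma emode_neg s k w : k < 0 -> emode s k w = 0.
Proof.
move=> k0; apply: (@scre_exp_neg _ _ _ _ 0) => // j j0.
by rewrite /dist_const ifF //; lia.
Qed.

Lemma emode0 s w : emode s 0 w = w.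
Proof.
rewrite -[LHS]/(dexp (dist_act (scre s)) (dist_const w) 0) (dexp_truncE (N := 1)).
  by rewrite /dexp_trunc big_ord1 invr1 scale1r.
move=> m m0; rewrite (@scre_iter_Lc _ _ _ _ _ 0) //.
by move=> j j0; rewrite /dist_const ifF //; lia.
Qed.

(** Newton's identities: with a_{-i} read as the power sum p_i, the modes on the vacuum are the
    complete symmetric functions for s = 1 and the signed elementary ones for s = -1. *)
Lemma emode_euler s k w (N : nat) : k <= N%:Z -> k%:~R *: emode s k w =
  s *: \sum_(i < N) heis M (- i.+1%:Z) (emode s (k - i.+1%:Z) w).
Proof.
move=> kN; have E0 : euler_op (dist_const w) = 0.
  apply/funext => j; rewrite /euler_op /dist_const.
  by case: eqP => [->|_]; rewrite ?scale0r ?scaler0.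
have := scre_exp_euler C0 s (Lc_const w); rewrite E0.
have -> : dist_exp (scre s) 0 = 0 :> (int -> M).
  have := scre_exp_lin s (-1) (@Lc0 _ M) (@Lc0 _ M).
  by rewrite scaler0 addr0 scaleN1r addNr.
move=> /esym/eqP; rewrite subr_eq0 => /eqP Ek.
rewrite -[LHS]/(euler_op (dist_exp (scre s) (dist_const w)) k) Ek.
rewrite (@pos_act_sum _ _ _ (dscre_lin s) (dscre_pos s) _ 0 _ N).
- by rewrite scaler_sumr; apply: eq_bigr.
- by move=> j j0; exact: emode_neg.
- by rewrite subr0.
Qed.

End VertexModes.

(** * Normal ordering of two vertex operators *)

Section OperatorIdentities.
Variables (C : fieldType) (M : fockSpace C).
Hypothesis C0 : forall n : nat, n.+1%:R != 0 :> C.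
Implicit Types (w : M) (n k j a b : int) (s : C) (x y : int -> int -> M).

Let int_nz := int_neq0 C0.

(* Multiplication of \sum x_(a,b) z^a w^b by (1 - z w)(1 - w / z). *)
Definition nabla x a b :=
  x a b - x (a - 1) (b - 1) - x (a + 1) (b - 1) + x a (b - 2).

(* w d/dw of \sum x_(a,b) z^a w^b is its product with
   \sum_n (s a_{-n} + c (z^n + z^{-n})) w^n. *)
Definition euler_rec s (c : C) x := forall a b (N : nat), b <= N%:Z ->
  b%:~R *: x a b =
    s *: (\sum_(i < N) heis M (- i.+1%:Z) (x a (b - i.+1%:Z))) +
    c *: (\sum_(i < N) (x (a - i.+1%:Z) (b - i.+1%:Z) +
                        x (a + i.+1%:Z) (b - i.+1%:Z))).

Definition pos2 x := forall a b, b < 0 -> x a b = 0.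

Lemma nabla_pos2 x : pos2 x -> pos2 (nabla x).
Proof. by move=> x0 a b b0; rewrite /nabla !x0 ?subr0 ?addr0 //; lia. Qed.

Lemma nabla0 x a : pos2 x -> nabla x a 0 = x a 0.
Proof. by move=> x0; rewrite /nabla !(x0 _ (_ - _)) ?subr0 ?addr0. Qed.

(** With P' the derivative of P in w, the series \sum_n (z^n + z^{-n}) w^n is - w P' / P, so its
    product with P is the polynomial (z + z^{-1}) w - 2 w^2. *)
Lemma nabla_telescope x a b (N : nat) : pos2 x -> b <= N%:Z ->
  \sum_(i < N) (nabla x (a - i.+1%:Z) (b - i.+1%:Z) +
                nabla x (a + i.+1%:Z) (b - i.+1%:Z)) =
  x (a - 1) (b - 1) + x (a + 1) (b - 1) - 2%:R *: x a (b - 2).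
Proof.
move=> x0 bN.
(* A partial sum leaves two boundary differences at distance N; their second index is negative once
   N >= b, and [pos2] removes them. *)
suff H : \sum_(i < N) (nabla x (a - i.+1%:Z) (b - i.+1%:Z) +
                       nabla x (a + i.+1%:Z) (b - i.+1%:Z)) =
  x (a - 1) (b - 1) + x (a + 1) (b - 1) - 2%:R *: x a (b - 2) -
  (x (a - N%:Z - 1) (b - N%:Z - 1) - x (a - N%:Z) (b - N%:Z - 2)) -
  (x (a + N%:Z + 1) (b - N%:Z - 1) - x (a + N%:Z) (b - N%:Z - 2)).
  by rewrite H !(x0 _ (b - N%:Z - _)) ?subr0 //; lia.
elim: N {bN} => [|N IH].
  have z0 c : (c - 0%:Z = c) * (c + 0%:Z = c) by split; lia.
  by rewrite big_ord0 !z0; lmod_ring.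
rewrite big_ord_recr IH /= /nabla.
have -> : a - N.+1%:Z - 1 = a - N%:Z - 2 by lia.
have -> : a + N.+1%:Z + 1 = a + N%:Z + 2 by lia.
have -> : b - N.+1%:Z = b - N%:Z - 1 by lia.
have -> : a - N.+1%:Z = a - N%:Z - 1 by lia.
have -> : a + N.+1%:Z = a + N%:Z + 1 by lia.
have -> : a - N%:Z - 1 + 1 = a - N%:Z by lia.
have -> : a + N%:Z + 1 - 1 = a + N%:Z by lia.
have -> : b - N%:Z - 1 - 1 = b - N%:Z - 2 by lia.
have -> : b - N%:Z - 1 - 2 = b - N%:Z - 2 - 1 by lia.
lmod_ring.
Qed.

(** Leibniz rule for P times x: since w P' is minus the scalar series times P, the coefficient c of
    that series drops by one. *)
Lemma nabla_rec s c x : pos2 x -> euler_rec s c x -> euler_rec s (c - 1) (nabla x).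
Proof.
move=> x0 xr a b N bN; rewrite [c - 1]addrC scalerDl scaleN1r {1}nabla_telescope //.
have -> : \sum_(i < N) (nabla x (a - i.+1%:Z) (b - i.+1%:Z) +
                       nabla x (a + i.+1%:Z) (b - i.+1%:Z)) =
  \sum_(i < N) (x (a - i.+1%:Z) (b - i.+1%:Z) + x (a + i.+1%:Z) (b - i.+1%:Z))
  - \sum_(i < N) (x (a - 1 - i.+1%:Z) (b - 1 - i.+1%:Z) +
                  x (a - 1 + i.+1%:Z) (b - 1 - i.+1%:Z))
  - \sum_(i < N) (x (a + 1 - i.+1%:Z) (b - 1 - i.+1%:Z) +
                  x (a + 1 + i.+1%:Z) (b - 1 - i.+1%:Z))
  + \sum_(i < N) (x (a - i.+1%:Z) (b - 2 - i.+1%:Z) +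
                  x (a + i.+1%:Z) (b - 2 - i.+1%:Z)).
  rewrite -!sumrB -big_split; apply: eq_bigr => i _; rewrite /nabla.
  have -> : a - 1 - i.+1%:Z = a - i.+1%:Z - 1 by lia.
  have -> : a - 1 + i.+1%:Z = a + i.+1%:Z - 1 by lia.
  have -> : a + 1 - i.+1%:Z = a - i.+1%:Z + 1 by lia.
  have -> : a + 1 + i.+1%:Z = a + i.+1%:Z + 1 by lia.
  have -> : b - 1 - i.+1%:Z = b - i.+1%:Z - 1 by lia.
  have -> : b - 2 - i.+1%:Z = b - i.+1%:Z - 2 by lia.
  by rewrite /=; lmod_ring.
have -> : \sum_(i < N) heis M (- i.+1%:Z) (nabla x a (b - i.+1%:Z)) =
  \sum_(i < N) heis M (- i.+1%:Z) (x a (b - i.+1%:Z))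
  - \sum_(i < N) heis M (- i.+1%:Z) (x (a - 1) (b - 1 - i.+1%:Z))
  - \sum_(i < N) heis M (- i.+1%:Z) (x (a + 1) (b - 1 - i.+1%:Z))
  + \sum_(i < N) heis M (- i.+1%:Z) (x a (b - 2 - i.+1%:Z)).
  rewrite -!sumrB -big_split; apply: eq_bigr => i _; rewrite /nabla.
  have -> : b - 1 - i.+1%:Z = b - i.+1%:Z - 1 by lia.
  have -> : b - 2 - i.+1%:Z = b - i.+1%:Z - 2 by lia.
  by rewrite linearD !linearB.
have e0 := xr a b N bN.
have e1 : (b - 1)%:~R *: x (a - 1) (b - 1) = _ := xr (a - 1) (b - 1) N _.
have e2 : (b - 1)%:~R *: x (a + 1) (b - 1) = _ := xr (a + 1) (b - 1) N _.
have e3 : (b - 2)%:~R *: x a (b - 2) = _ := xr a (b - 2) N _.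
move: e0 (e1 ltac:(lia)) (e2 ltac:(lia)) (e3 ltac:(lia)) => {}e0 {}e1 {}e2 {}e3.
have -> : b%:~R *: nabla x a b = b%:~R *: x a b - (b - 1)%:~R *: x (a - 1) (b - 1)
  - (b - 1)%:~R *: x (a + 1) (b - 1) + (b - 2)%:~R *: x a (b - 2)
  - x (a - 1) (b - 1) - x (a + 1) (b - 1) + 2%:R *: x a (b - 2).
  by rewrite /nabla !rmorphB; lmod_ring.
rewrite e0 e1 e2 e3; lmod_ring.
Qed.

Lemma euler_rec_uniq s c x y : pos2 x -> pos2 y ->
  euler_rec s c x -> euler_rec s c y -> (forall a, x a 0 = y a 0) ->
  forall a b, x a b = y a b.
Proof.
move=> x0 y0 xr yr xy0.
suff H (n : nat) a : x a n%:Z = y a n%:Z.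
  move=> a b; have [b0|b0] := ltP b 0; first by rewrite x0 // y0.
  by have -> : b = (absz b)%:Z by lia.
elim/ltn_ind: n a => n IH a.
have [->|n0] := eqVneq n 0%N; first exact: xy0.
apply: (scalerI (int_nz (j := n%:Z) _)); first by lia.
rewrite (xr a n%:Z n) // (yr a n%:Z n) //.
have E a' (i : 'I_n) : x a' (n%:Z - i.+1%:Z) = y a' (n%:Z - i.+1%:Z).
  have -> : n%:Z - i.+1%:Z = (n - i.+1)%N%:Z by have := ltn_ord i; lia.
  by apply: IH; have := ltn_ord i; lia.
congr (_ *: _ + _ *: _); apply: eq_bigr => i _; first by rewrite E.
by rewrite !E.
Qed.

Local Notation vac := (vac M).

(** [kvac] is the product of two vertex operators on the vacuum, [nvac] its normally ordered form,
    where the left factor has lost its annihilation part. *)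
Definition kvac s t a b := vmode s a (emode t b vac).
Definition nvac s t a b := emode s a (emode t b vac).

Lemma vmode0 s k : vmode s k (0 : M) = 0.
Proof. exact: (linf0 (vmode_lin s k)). Qed.

Lemma emode00 s k : emode s k (0 : M) = 0.
Proof. exact: (linf0 (emode_lin s k)). Qed.

Lemma kvac_pos2 s t : pos2 (kvac s t).
Proof. by move=> a b b0; rewrite /kvac emode_neg // vmode0. Qed.

Lemma nvac_pos2 s t : pos2 (nvac s t).
Proof. by move=> a b b0; rewrite /nvac (emode_neg t _ b0) emode00. Qed.

Lemma kvac_rec s t : euler_rec t (- (t * s)) (kvac s t).
Proof.
move=> a b N bN; rewrite /kvac -(linfZ (vmode_lin s a)).
rewrite (emode_euler C0 _ _ bN) (linfZ (vmode_lin s a)).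
rewrite (linf_sum (vmode_lin s a)).
under eq_bigr do rewrite vmode_cre //.
by rewrite sumrB -scaler_sumr; lmod_ring.
Qed.

Lemma nvac_rec s t : euler_rec t 0 (nvac s t).
Proof.
move=> a b N bN; rewrite /nvac -(linfZ (emode_lin s a)) (emode_euler C0 _ _ bN).
rewrite (linfZ (emode_lin s a)) (linf_sum (emode_lin s a)) scale0r addr0.
by congr (_ *: _); apply: eq_bigr => i _; rewrite emode_cre.
Qed.

Lemma nvacC s t a b : nvac s t a b = nvac t s b a.
Proof.
apply: (euler_rec_uniq (s := t) (c := 0) (x := nvac s t)
  (y := fun a b => nvac t s b a)).
- exact: nvac_pos2.
- by move=> a' b' b0; rewrite /nvac emode_neg.
- exact: nvac_rec.
- move=> a' b' N bN; rewrite scale0r addr0 /nvac; exact: emode_euler.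
- by move=> a'; rewrite /nvac !emode0.
Qed.

Lemma kvac0 s t a : kvac s t a 0 = nvac s t a 0.
Proof. by rewrite /kvac /nvac emode0 vmode_vac. Qed.

Lemma kvac_same s a b : s * s = 1 -> kvac s s a b = nabla (nvac s s) a b.
Proof.
move=> ss; apply: (euler_rec_uniq (s := s) (c := -1)).
- exact: kvac_pos2.
- exact/nabla_pos2/nvac_pos2.
- by have := @kvac_rec s s; rewrite ss.
- by have := nabla_rec (@nvac_pos2 s s) (@nvac_rec s s); rewrite sub0r.
- by move=> a'; rewrite nabla0 ?kvac0 //; exact: nvac_pos2.
Qed.

(** Reordering contributes 1 / P, that is c = 1 in the recursion; [nabla] brings it back to 0
    without any infinite expansion. *)
Lemma kvac_opp s a b : s * s = 1 -> nabla (kvac s (- s)) a b = nvac s (- s) a b.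
Proof.
move=> ss; apply: (euler_rec_uniq (s := - s) (c := 0)).
- exact/nabla_pos2/kvac_pos2.
- exact: nvac_pos2.
- have := nabla_rec (@kvac_pos2 s (- s)) (@kvac_rec s (- s)).
  by rewrite mulNr ss opprK subrr.
- exact: nvac_rec.
- by move=> a'; rewrite nabla0 ?kvac0 //; exact: kvac_pos2.
Qed.

Lemma vmode_comb s k (c : C) (u v w : M) : vmode s k (u - c *: (v + w)) =
  vmode s k u - c *: (vmode s k v + vmode s k w).
Proof.
rewrite -scaleN1r addrC vmode_lin (linfZ (vmode_lin s k)).
by rewrite (linfD (vmode_lin s k)) scaleN1r addrC.
Qed.

(** z P = (z - w)(1 - z w) changes sign when z and w are exchanged, while the normally ordered
    product is symmetric. The indices [p] and [q] come with equations so that the shifted instances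
    needed in the induction match up to [lia]. *)
Lemma vmode_anti s w a b p q : s * s = 1 -> p = a + 1 -> q = b + 1 ->
  vmode s a (vmode s q w) = - vmode s b (vmode s p w).
Proof.
move=> ss; move: w a b p q; apply: vac_gen.
- move=> a b p q -> ->; rewrite !vmode_vac // -!/(kvac _ _ _ _) !kvac_same //.
  rewrite /nabla.
  have -> : b + 1 - 1 = b by lia.
  have -> : a + 1 - 1 = a by lia.
  have -> : b + 1 - 2 = b - 1 by lia.
  have -> : a + 1 - 2 = a - 1 by lia.
  rewrite [nvac s s a (b + 1)]nvacC [nvac s s (a - 1) b]nvacC.
  by rewrite [nvac s s (a + 1) b]nvacC [nvac s s a (b - 1)]nvacC; lmod_ring.
- move=> c u v Hu Hv a b p q pa qb; rewrite !vmode_lin (Hu a b p q) //.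
  by rewrite (Hv a b p q) //; lmod_ring.
- move=> n w n0 H a b p q pa qb; rewrite !(vmode_cre C0) // !vmode_comb.
  rewrite !(vmode_cre C0) //.
  rewrite (H a b p q) // (H (a - n) b (p - n) q) //; [|lia].
  rewrite (H (a + n) b (p + n) q) //; [|lia].
  rewrite (H a (b - n) p (q - n)) //; [|lia].
  rewrite (H a (b + n) p (q + n)) //; [|lia].
  by rewrite linearN /=; lmod_ring.
Qed.

Lemma int_window (V : zmodType) (g : int -> V) (c : int) (K : nat) :
  (forall q, (q < - c) || (K%:Z - c <= q) -> g q = 0) ->
  \sum_(j < K) g (j%:Z - c) = \sum_(q \in [set: int]) g q.
Proof.
move=> g0; rewrite (@fsumT_seq _ _ [seq i%:Z - c | i <- iota 0 K]).
  rewrite undup_id ?map_inj_uniq ?iota_uniq //; last by move=> i j; lia.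
  by rewrite big_map -(big_mkord xpredT (fun i => g (i%:Z - c))) /index_iota subn0.
move=> q qK; apply: g0; apply: contraNT qK; rewrite negb_or => qc; apply/mapP.
by exists (absz (q + c)); rewrite ?mem_iota; lia.
Qed.

(* E^-(z) E^+(z) = 1 on the vacuum. *)
Lemma nvac_inverse (n : nat) :
  \sum_(j < n.+1) nvac (-1) 1 (n%:Z - j%:Z) j%:Z = if n == 0%N then vac else 0.
Proof.
case: n => [|n]; first by rewrite big_ord1 subr0 /nvac !emode0.
set m := n.+1; apply: (scalerI (int_nz (j := m%:Z) _)); first by lia.
rewrite scaler0 scaler_sumr.
pose f p q := nvac (-1) 1 p q.
have f0 p q : (p < 0) || (q < 0) -> f p q = 0.
  by case/orP => h; rewrite /f /nvac; [rewrite (emode_neg (-1))|rewrite (emode_neg 1) ?emode00].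
(* Split m as (m - j) + j and use Newton's recursion on each factor; for a fixed creation operator
   the two inner sums are shifts of each other and cancel. *)
transitivity (\sum_(j < m.+1) (- \sum_(i < m.+1) heis M (- i.+1%:Z) (f (m%:Z - j%:Z - i.+1%:Z) j%:Z)
   + \sum_(i < m.+1) heis M (- i.+1%:Z) (f (m%:Z - j%:Z) (j%:Z - i.+1%:Z)))).
  apply: eq_bigr => j _.
  have jm : (j <= m)%N by rewrite -ltnS.
  have -> : m%:Z%:~R = (m%:Z - j%:Z)%:~R + j%:Z%:~R :> C by rewrite -rmorphD subrK.
  rewrite scalerDl {1}/nvac (emode_euler C0 _ _ (N := m.+1)); last lia.
  rewrite scaleN1r (@nvac_rec (-1) 1 _ _ m.+1); last lia.
  by rewrite scale0r addr0 scale1r.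
rewrite big_split /= sumrN exchange_big [X in _ + X]exchange_big /=.
apply/eqP; rewrite addrC subr_eq0; apply/eqP; apply: eq_bigr => i _.
rewrite -!linear_sum; congr (heis M _ _).
pose g q := f (m%:Z - i.+1%:Z - q) q.
transitivity (\sum_(j < m.+1) g (j%:Z - i.+1%:Z)).
  by apply: eq_bigr => j _; apply: (f_equal2 f); lia.
transitivity (\sum_(j < m.+1) g (j%:Z - 0)); last first.
  by apply: eq_bigr => j _; rewrite subr0; apply: (f_equal2 f); lia.
by rewrite !int_window // => q qm; apply: f0; have := ltn_ord i; lia.
Qed.


End OperatorIdentities.

(** * Exchange relations and reflection at the dual vacuum *)

Section ModeRelations.
Variables (C : fieldType) (M : fockSpace C).
Hypothesis C0 : forall n : nat, n.+1%:R != 0 :> C.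
Implicit Types (w : M) (n k j a b : int) (s : C).

Local Notation vac := (vac M).

(* Coefficient of z^a w^b in U*(z) U(w) + (z / w) U(w) U*(z), without the
   factors 1 - z and 1 + w. *)
Definition mixed a b w : M :=
  vmode (-1) a (vmode 1 b w) + vmode 1 (b + 1) (vmode (-1) (a - 1) w).

Lemma mixed_lin a b (c : C) (u v : M) :
  mixed a b (c *: u + v) = c *: mixed a b u + mixed a b v.
Proof. by rewrite /mixed !vmode_lin; lmod_ring. Qed.

Lemma mixed_cre a b n w : 0 < n -> mixed a b (heis M (- n) w) =
  heis M (- n) (mixed a b w) + (mixed (a - n) b w + mixed (a + n) b w) -
  (mixed a (b - n) w + mixed a (b + n) w).
Proof.
move=> n0; rewrite /mixed !(vmode_cre C0) // !vmode_comb !(vmode_cre C0) //.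
have -> : a - n - 1 = a - 1 - n by lia.
have -> : a + n - 1 = a - 1 + n by lia.
have -> : b - n + 1 = b + 1 - n by lia.
have -> : b + n + 1 = b + 1 + n by lia.
by rewrite linearD /=; lmod_ring.
Qed.

(** After multiplication by 1 - z w, the two products are the normally ordered one times the two
    expansions of 1 / (1 - w / z), with opposite signs. Their sum is the normally ordered product
    times the delta function of z / w, and [nvac_inverse] evaluates that product at z = w to the
    vacuum. *)
Lemma mixed_vac_diff a b : mixed a b vac - mixed (a - 1) (b - 1) vac =
  if a + b == 0 then vac else 0.
Proof.
pose K := @kvac C M (-1) 1; pose L := @kvac C M 1 (-1).
pose K' a b := K a b - K (a - 1) (b - 1).
pose L' b a := L b a - L (b - 1) (a - 1).
have sq1 : (-1) * (-1) = 1 :> C by rewrite mulrNN mulr1.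
have KN c d : K' c d - K' (c + 1) (d - 1) = nvac M (-1) 1 c d.
  have := @kvac_opp C M C0 (-1) c d sq1; rewrite opprK /nabla /K' -/K => <-.
  have -> : c + 1 - 1 = c by lia.
  have -> : d - 1 - 1 = d - 2 by lia.
  by lmod_ring.
have LN c d : L' d c - L' (d + 1) (c - 1) = nvac M (-1) 1 c d.
  have := @kvac_opp C M C0 1 d c (mulr1 1); rewrite nvacC // => <-; rewrite /nabla /L' -/L.
  have -> : d + 1 - 1 = d by lia.
  have -> : c - 1 - 1 = c - 2 by lia.
  by lmod_ring.
have K'0 c d : d < 0 -> K' c d = 0.
  by move=> d0; rewrite /K' /K !kvac_pos2 ?subr0 //; lia.
have L'0 c d : c < 0 -> L' d c = 0.
  by move=> d0; rewrite /L' /L !kvac_pos2 ?subr0 //; lia.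
pose Y c d := K' c d + L' (d + 1) (c - 1).
have YE c d : mixed c d vac - mixed (c - 1) (d - 1) vac = Y c d.
  rewrite /mixed !vmode_vac /Y /K' /L' /K /L /kvac.
  have -> : d - 1 + 1 = d by lia.
  have -> : d + 1 - 1 = d by lia.
  by lmod_ring.
have Yshift c d : Y c d = Y (c + 1) (d - 1).
  have := KN c d; rewrite -(LN c d) /Y.
  have -> : d - 1 + 1 = d by lia.
  have -> : c + 1 - 1 = c by lia.
  move=> /eqP; rewrite subr_eq => /eqP ->; lmod_ring.
have Yn (n : nat) c d : Y c d = Y (c + n%:Z) (d - n%:Z).
  elim: n c d => [|n IH] c d; first by apply: (f_equal2 Y); lia.
  by rewrite Yshift IH; apply: (f_equal2 Y); lia.
have Y0 c d : Y c d = Y 0 (c + d).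
  have [c0|c0] := leP c 0; first by rewrite (Yn (absz c)); apply: (f_equal2 Y); lia.
  by rewrite (Yn (absz c) 0); apply: (f_equal2 Y); lia.
(* [Y] is constant along a + b; at first index 0 the summand [L'] has a negative index and vanishes,
   and [K'] is the specialization z = w of [nvac]. *)
rewrite YE Y0 /Y L'0 ?addr0 //.
have [ab|ab] := ltP (a + b) 0; first by rewrite K'0 // ifF //; lia.
have -> : a + b = (absz (a + b))%:Z by lia.
move: (absz _) => n {ab}.
have K'sum (m : nat) c : K' c m%:Z =
    \sum_(j < m.+1) nvac M (-1) 1 (c + m%:Z - j%:Z) j%:Z.
  elim: m c => [|m IH] c.
    rewrite big_ord1; have := KN c 0; rewrite (K'0 (c + 1)) // subr0 => ->.
    by rewrite subr0 addr0.
  have := KN c m.+1%:Z; have -> : m.+1%:Z - 1 = m%:Z by lia.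
  move/eqP; rewrite subr_eq => /eqP ->; rewrite IH [RHS]big_ord_recr /= [LHS]addrC.
  congr (_ + _); last by apply: (f_equal2 (nvac M (-1) 1)); lia.
  by apply: eq_bigr => j _; apply: (f_equal2 (nvac M (-1) 1)); lia.
rewrite K'sum; have := @nvac_inverse C M C0 n.
have -> : (n%:Z == 0) = (n == 0%N) by lia.
by move=> <-; apply: eq_bigr => j _; rewrite add0r.
Qed.

Lemma mixed_vac_neg a b : a < 1 -> b < 0 -> mixed a b vac = 0.
Proof.
move=> a1 b0; rewrite /mixed !vmode_vac emode_neg // vmode0 add0r.
by rewrite emode_neg ?vmode0 //; lia.
Qed.

(** z - w annihilates the delta function, so (z - w) times [mixed] is unchanged by multiplication by
    z w; it vanishes far down each diagonal, hence everywhere. *)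
Lemma mixed_vac_swap a b : mixed (a - 1) b vac = mixed a (b - 1) vac.
Proof.
pose Z a b := mixed (a - 1) b vac - mixed a (b - 1) vac.
have ZS c d : Z c d = Z (c - 1) (d - 1).
  have := mixed_vac_diff (c - 1) d; have := mixed_vac_diff c (d - 1).
  have -> : c - 1 + d = c + (d - 1) by lia.
  move=> <- /eqP; rewrite subr_eq /Z => /eqP ->; lmod_ring.
have Zn (n : nat) c d : Z c d = Z (c - n%:Z) (d - n%:Z).
  elim: n c d => [|n IH] c d; first by apply: (f_equal2 Z); lia.
  by rewrite ZS IH; apply: (f_equal2 Z); lia.
apply/eqP; rewrite -subr_eq0 -/(Z a b) (Zn (absz a + absz b).+1) /Z.
by rewrite !mixed_vac_neg ?subr0 //; lia.
Qed.

(** Commuting past a_{-n} produces the factor z^n + z^{-n} - w^n - w^{-n}, which kills the delta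
    function of z / w, so the vacuum identity passes to every creation word. *)
Lemma mixed_diff w a b :
  mixed a b w - mixed (a - 1) (b - 1) w = if a + b == 0 then w else 0.
Proof.
move: w a b; apply: vac_gen.
- exact: mixed_vac_diff.
- move=> c u v Hu Hv a b; rewrite !mixed_lin.
  transitivity (c *: (mixed a b u - mixed (a - 1) (b - 1) u)
    + (mixed a b v - mixed (a - 1) (b - 1) v)); first by lmod_ring.
  by rewrite Hu Hv; case: eqP; rewrite // scaler0 addr0.
- move=> n w n0 H a b; rewrite !mixed_cre //.
  transitivity (heis M (- n) (mixed a b w - mixed (a - 1) (b - 1) w)
    + ((mixed (a - n) b w - mixed (a - n - 1) (b - 1) w)
    + (mixed (a + n) b w - mixed (a + n - 1) (b - 1) w))
    - ((mixed a (b - n) w - mixed (a - 1) (b - n - 1) w)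
    + (mixed a (b + n) w - mixed (a - 1) (b + n - 1) w))).
    have -> : a - n - 1 = a - 1 - n by lia.
    have -> : a + n - 1 = a - 1 + n by lia.
    have -> : b - n - 1 = b - 1 - n by lia.
    have -> : b + n - 1 = b - 1 + n by lia.
    by rewrite linearB /=; lmod_ring.
  rewrite !H.
  have -> : a - n + b = a + (b - n) by lia.
  have -> : a + n + b = a + (b + n) by lia.
  by rewrite addrK; case: eqP => _; rewrite ?linear0.
Qed.

Lemma mixed_swap w a b : mixed (a - 1) b w = mixed a (b - 1) w.
Proof.
move: w a b; apply: vac_gen.
- exact: mixed_vac_swap.
- by move=> c u v Hu Hv a b; rewrite !mixed_lin Hu Hv.
- move=> n w n0 H a b; rewrite !mixed_cre // H.
  have -> : a - 1 - n = a - n - 1 by lia.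
  have -> : a - 1 + n = a + n - 1 by lia.
  have -> : b - 1 - n = b - n - 1 by lia.
  have -> : b - 1 + n = b + n - 1 by lia.
  by rewrite !H.
Qed.

Lemma U_modeE n w : U_mode n w = vmode 1 (- n) w + vmode 1 (- n - 1) w.
Proof. by rewrite /U_mode !U_coreE. Qed.

Lemma Ustar_modeE n w : Ustar_mode n w = vmode (-1) n w - vmode (-1) (n - 1) w.
Proof. by rewrite /Ustar_mode !Ustar_coreE. Qed.

Lemma Ustar_mode_lin n (c : C) (u v : M) :
  Ustar_mode n (c *: u + v) = c *: Ustar_mode n u + Ustar_mode n v.
Proof. by rewrite !Ustar_modeE !vmode_lin; lmod_ring. Qed.

Lemma U_mode_lin n (c : C) (u v : M) :
  U_mode n (c *: u + v) = c *: U_mode n u + U_mode n v.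
Proof. by rewrite !U_modeE !vmode_lin; lmod_ring. Qed.

Lemma Ustar_mode_cre k n w : 0 < n -> Ustar_mode k (heis M (- n) w) =
  heis M (- n) (Ustar_mode k w) + (Ustar_mode (k - n) w + Ustar_mode (k + n) w).
Proof.
move=> n0; rewrite !Ustar_modeE !(vmode_cre C0) //.
have -> : k - n - 1 = k - 1 - n by lia.
have -> : k + n - 1 = k - 1 + n by lia.
by rewrite linearB /=; lmod_ring.
Qed.

Lemma vmodeD s k (u v : M) : vmode s k (u + v) = vmode s k u + vmode s k v.
Proof. exact: (linfD (vmode_lin s k)). Qed.

Lemma vmodeB s k (u v : M) : vmode s k (u - v) = vmode s k u - vmode s k v.
Proof. by rewrite vmodeD -!scaleN1r (linfZ (vmode_lin s k)). Qed.

(** (1 - z)(1 + w) = (1 - z w) - (z - w): the first part gives the delta function by [mixed_diff],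
    the second gives zero by [mixed_swap]. *)
Lemma Ustar_U m n w : Ustar_mode m (U_mode n w) =
  (if m == n then w else 0) - U_mode (n - 1) (Ustar_mode (m - 1) w).
Proof.
rewrite !Ustar_modeE !U_modeE !(vmodeB, vmodeD).
have H1 := mixed_diff w m (- n).
have H2 := mixed_swap w m (- n).
have -> : (m == n) = (m - n == 0) by lia.
rewrite -H1.
have -> : - (n - 1) = - n + 1 by lia.
have -> : - n + 1 - 1 = - n by lia.
move/eqP: H2; rewrite -subr_eq0 => /eqP H2; apply/eqP; rewrite -subr_eq0 -oppr_eq0 -H2.
rewrite /mixed; have -> : - n - 1 + 1 = - n by lia.
by apply/eqP; lmod_ring.
Qed.

Lemma Ustar_anti p q w : Ustar_mode p (Ustar_mode q w) =
  - Ustar_mode (q - 1) (Ustar_mode (p + 1) w).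
Proof.
have sq1 : (-1) * (-1) = 1 :> C by rewrite mulrNN mulr1.
rewrite !Ustar_modeE !vmodeB.
rewrite (@vmode_anti _ _ C0 _ w p (q - 1) (p + 1) q) //; [|lia].
rewrite (@vmode_anti _ _ C0 _ w p (q - 2) (p + 1) (q - 1)) //; [|lia].
rewrite (@vmode_anti _ _ C0 _ w (p - 1) (q - 1) p q) //; [|lia|lia].
rewrite (@vmode_anti _ _ C0 _ w (p - 1) (q - 2) p (q - 1)) //; [|lia|lia].
have -> : p + 1 - 1 = p by lia.
have -> : q - 1 - 1 = q - 2 by lia.
by lmod_ring.
Qed.

Lemma U_anti p q w : U_mode p (U_mode q w) = - U_mode (q + 1) (U_mode (p - 1) w).
Proof.
rewrite !U_modeE !vmodeD.
rewrite (@vmode_anti _ _ C0 1 w (- p) (- q - 1) (- p + 1) (- q)) ?mulr1 //; [|lia].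
rewrite (@vmode_anti _ _ C0 1 w (- p) (- q - 2) (- p + 1) (- q - 1)) ?mulr1 //; [|lia].
rewrite (@vmode_anti _ _ C0 1 w (- p - 1) (- q - 1) (- p) (- q)) ?mulr1 //; [|lia|lia].
rewrite (@vmode_anti _ _ C0 1 w (- p - 1) (- q - 2) (- p) (- q - 1)) ?mulr1 //; [|lia|lia].
have -> : - (q + 1) = - q - 1 by lia.
have -> : - q - 1 - 1 = - q - 2 by lia.
have -> : - (p - 1) = - p + 1 by lia.
have -> : - p + 1 - 1 = - p by lia.
by lmod_ring.
Qed.

(** The dual vacuum kills the creation half, and the annihilation exponent is symmetric under z -> 1
    / z. *)
Lemma dvac_vmodeN s w k : dvac M (vmode s k w) = dvac M (vmode s (- k) w).
Proof.
move: w k; apply: vac_gen.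
- move=> k; rewrite !vmode_vac.
  suff H j : dvac M (emode s j vac) = if j == 0 then 1 else 0.
    by rewrite !H; have -> : (- k == 0) = (k == 0) by lia.
  have [j0|j0|->] := ltgtP j 0.
  - by rewrite emode_neg ?linear0.
  - have jnz : j%:~R != 0 :> C by apply: int_neq0 => //; lia.
    apply: (mulfI jnz).
    rewrite mulr0 -linearZ_LR (emode_euler C0 _ _ (N := absz j)); last lia.
    rewrite linearZ_LR linear_sum big1 ?mulr0 // => i _.
    by rewrite dvac_heis.
  - by rewrite emode0 dvac_vac.
- by move=> c u v Hu Hv k; rewrite !vmode_lin !linearP Hu Hv.
- move=> n w n0 H k; rewrite !(vmode_cre C0) // !linearB !dvac_heis //=.
  rewrite !linearZ_LR !linearD /= (H (k - n)) (H (k + n)).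
  have -> : - (k - n) = - k + n by lia.
  have -> : - (k + n) = - k - n by lia.
  by rewrite [X in _ * X]addrC.
Qed.

(** Only the prefactor breaks the symmetry: 1 + z^{-1} = z^{-1} (1 + z), whereas 1 - z^{-1} = -
    z^{-1} (1 - z) gives [dvac_Ustar] its sign. *)
Lemma dvac_U n w : dvac M (U_mode n w) = dvac M (U_mode (- n - 1) w).
Proof.
rewrite !U_modeE !linearD /= dvac_vmodeN [X in _ + X]dvac_vmodeN.
have -> : - (- n - 1) - 1 = - - n by lia.
have -> : - (- n - 1) = n + 1 by lia.
by rewrite addrC.
Qed.

Lemma dvac_Ustar n w : dvac M (Ustar_mode n w) = - dvac M (Ustar_mode (1 - n) w).
Proof.
rewrite !Ustar_modeE !linearB /= dvac_vmodeN [X in _ - X]dvac_vmodeN.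
have -> : - (n - 1) = 1 - n by lia.
have -> : 1 - n - 1 = - n by lia.
by rewrite opprB.
Qed.

Lemma U_vac n : 0 < n -> U_mode n vac = 0.
Proof. by move=> n0; rewrite U_modeE !vmode_vac !emode_neg ?addr0 //; lia. Qed.

Lemma Ustar_vac n : n < 0 -> Ustar_mode n vac = 0.
Proof. by move=> n0; rewrite Ustar_modeE !vmode_vac !emode_neg ?subr0 //; lia. Qed.

Lemma Ustar0_vac : Ustar_mode 0 vac = vac.
Proof. by rewrite Ustar_modeE !vmode_vac emode0 emode_neg ?subr0. Qed.

End ModeRelations.

(** * Orthonormality of bras and kets *)

Section Pairing.
Variables (C : fieldType) (M : fockSpace C).
Hypothesis C0 : forall n : nat, n.+1%:R != 0 :> C.
Implicit Types (w : M) (p : int) (kappa lambda nu : seq nat).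

(** Each exchange with a mode of U lowers the index of U* further, so it never meets an equal index
    and ends up killing the vacuum. *)
Lemma so_ket_annihilate kappa p : 0 < p -> (forall k, k \in kappa -> k%:Z < p) ->
  Ustar_mode (- p) (so_ket M kappa) = 0.
Proof.
elim: kappa p => [|k kappa IH] p p0 kp /=; first by rewrite Ustar_vac //; lia.
have kp' : k%:Z < p by apply: kp; rewrite inE eqxx.
rewrite (Ustar_U C0) ifF; last by lia.
have -> : - p - 1 = - (p + 1) by lia.
rewrite IH; first by rewrite (linf0 (U_mode_lin _)) subr0.
  by lia.
by move=> j jk; have := kp j; rewrite inE jk orbT => /(_ isT); lia.
Qed.

(** Each exchange costs one unit of the index; [size kappa] exchanges leave it positive in front of
    the vacuum. *)
Lemma so_ket_U_gt kappa p : (size kappa)%:Z < p -> U_mode p (so_ket M kappa) = 0.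
Proof.
elim: kappa p => [|k kappa IH] p /= kp; first by rewrite U_vac.
rewrite (U_anti C0) IH; last by lia.
by rewrite (linf0 (U_mode_lin _)) oppr0.
Qed.

(** With s the size of [nu], the mode U_{- p} travels left through the bra without contraction and
    arrives as U_{- p - s}; reflection at the dual vacuum makes it U_{p + s - 1}, and the way back
    adds s again. *)
Lemma so_bra_reflect nu p w : (forall k, k \in nu -> k%:Z < p) ->
  so_bra nu (U_mode (- p) w) = so_bra nu (U_mode (p + (size nu).*2%:Z - 1) w).
Proof.
rewrite /so_bra; elim: nu p w => [|k nu IH] p w kp /=.
  rewrite (dvac_U C0).
  by have -> : - - p - 1 = p + 0.*2%:Z - 1 by lia.
have kp' : k%:Z < p by apply: kp; rewrite inE eqxx.
rewrite !(Ustar_U C0) !ifF; try lia.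
rewrite !sub0r.
have brN v : dvac M (foldl (fun v (p : nat) => Ustar_mode (- p%:Z) v) (- v) nu) =
    - dvac M (foldl (fun v (p : nat) => Ustar_mode (- p%:Z) v) v nu).
  elim: nu v {IH kp} => [|j nu IHn] v /=; first by rewrite linearN.
  by rewrite -scaleN1r (linfZ (Ustar_mode_lin _)) scaleN1r IHn.
rewrite !brN; congr (- _).
have -> : - p - 1 = - (p + 1) by lia.
rewrite IH; last by move=> j jk; have := kp j; rewrite inE jk orbT => /(_ isT); lia.
have -> : p + 1 + (size nu).*2%:Z - 1 = p + (size nu).+1.*2%:Z - 1 - 1 by lia.
by have -> : - k%:Z - 1 = - (k%:Z + 1) by lia.
Qed.

Lemma so_bra0 nu : so_bra nu (0 : M) = 0.
Proof.
rewrite /so_bra; elim: nu => [|k nu IH] /=; first by rewrite linear0.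
by rewrite (linf0 (Ustar_mode_lin _)).
Qed.

Lemma gen_partition_cons k nu : gen_partition (k :: nu) ->
  gen_partition nu /\ forall j, j \in nu -> (j <= k)%N.
Proof.
rewrite /gen_partition /= => knu; split; first exact: path_sorted knu.
move=> j jnu; have /allP := order_path_min (rev_trans leq_trans) knu.
exact.
Qed.

Lemma so_bra_ket nu lambda : size nu = size lambda ->
  gen_partition nu -> gen_partition lambda ->
  so_bra nu (so_ket M lambda) = (nu == lambda)%:R.
Proof.
elim: nu lambda => [|k nu IH] [|j lambda] //=.
  by rewrite /so_bra /= dvac_vac.
case=> snl Pk Pj.
have [Pnu knu] := gen_partition_cons Pk; have [Pla jla] := gen_partition_cons Pj.
have [kj|jk] := ltnP k j.
  (* A ket entry exceeding all bra entries is reflected into a mode whose index is too large for the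
     remaining ket. *)
  rewrite so_bra_reflect; last first.
    by move=> i; rewrite inE => /orP[/eqP ->|/knu]; lia.
  rewrite so_ket_U_gt; last by rewrite /= snl; lia.
  by rewrite so_bra0 eqseq_cons (ltn_eqF kj).
rewrite /so_bra /= (Ustar_U C0).
have -> : - k%:Z - 1 = - (k%:Z + 1) by lia.
rewrite so_ket_annihilate; [|lia|by move=> i /jla; lia].
rewrite (linf0 (U_mode_lin _)) subr0 eqseq_cons.
have -> : (- k%:Z == - j%:Z) = (k == j) by lia.
case: eqP => _ /=; last exact: so_bra0.
by rewrite -IH.
Qed.

Lemma so_bra_vac nu : gen_partition nu ->
  so_bra nu (vac M) = (all (pred1 0%N) nu)%:R.
Proof.
elim: nu => [|[|k] nu IH] /= Pk; first by rewrite /so_bra /= dvac_vac.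
  rewrite /so_bra /= oppr0 Ustar0_vac //; apply: IH.
  by have [] := gen_partition_cons Pk.
by rewrite /so_bra /= Ustar_vac //; exact: so_bra0.
Qed.

(** Exchange and reflection leave the set of partitions, so the entries range over all integers. *)
Definition zbra (ms : seq int) w : C := dvac M (foldl (fun v p => Ustar_mode (- p) v) w ms).

Lemma so_braE nu w : so_bra nu w = zbra (map Posz nu) w.
Proof. by rewrite /so_bra /zbra; elim: nu w => //= k nu IH w. Qed.

Lemma zbra_cons p ms w : zbra (p :: ms) w = zbra ms (Ustar_mode (- p) w).
Proof. by []. Qed.

Lemma zbra_lin ms (c : C) (u v : M) : zbra ms (c *: u + v) = c * zbra ms u + zbra ms v.
Proof.
elim: ms u v => [|p ms IH] u v; first by rewrite /zbra /= linearP.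
by rewrite !zbra_cons Ustar_mode_lin IH.
Qed.

Lemma zbraD ms (u v : M) : zbra ms (u + v) = zbra ms u + zbra ms v.
Proof. by have := zbra_lin ms 1 u v; rewrite scale1r mul1r. Qed.

Lemma zbra0 ms : zbra ms (0 : M) = 0.
Proof. by have := zbra_lin ms (-1) 0 0; rewrite scaler0 addr0 mulN1r addNr. Qed.

Lemma zbraN ms (u : M) : zbra ms (- u) = - zbra ms u.
Proof. by apply/eqP; rewrite -addr_eq0 -zbraD addNr zbra0. Qed.

Lemma zbra_cat s1 s2 w :
  zbra (s1 ++ s2) w = zbra s2 (foldl (fun v p => Ustar_mode (- p) v) w s1).
Proof. by rewrite /zbra foldl_cat. Qed.

Lemma zbra_swap s1 s2 p q w :
  zbra (s1 ++ p :: q :: s2) w = - zbra (s1 ++ q - 1 :: p + 1 :: s2) w.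
Proof.
rewrite !zbra_cat !zbra_cons (Ustar_anti C0) zbraN; congr (- zbra _ _).
have -> : - (q - 1) = - q + 1 by lia.
by have -> : - (p + 1) = - p - 1 by lia.
Qed.

Lemma zbra_last s p w : zbra (rcons s p) w = - zbra (rcons s (- p - 1)) w.
Proof.
rewrite -!cats1 !zbra_cat !zbra_cons /zbra /= (dvac_Ustar C0).
by have -> : - (- p - 1) = 1 - - p by lia.
Qed.

Definition bump1 (I : eqType) (f : I -> int) (i : I) (m : int) : I -> int :=
  fun j => if j == i then f j + m else f j.

(** a_{-m} moves left to the dual vacuum, which kills it; each U* passed on the way contributes its
    index raised and lowered by m. Labelling positions by the distinct elements of [r] makes a bump
    hit exactly one entry. *)
Lemma zbra_cre (I : eqType) (r : seq I) (f : I -> int) m w : uniq r -> 0 < m ->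
  zbra (map f r) (heis M (- m) w) =
  \sum_(i <- r) (zbra (map (bump1 f i m) r) w + zbra (map (bump1 f i (- m)) r) w).
Proof.
move=> ur m0; elim: r w ur => [|j r IH] w /=.
  by rewrite big_nil /zbra /= dvac_heis.
case/andP=> jr ur; rewrite zbra_cons (Ustar_mode_cre C0) //.
rewrite zbraD zbraD IH // big_cons.
have bj e : zbra (bump1 f j e j :: map (bump1 f j e) r) w =
    zbra (map f r) (Ustar_mode (- f j - e) w).
  rewrite zbra_cons /bump1 eqxx; have -> : - (f j + e) = - f j - e by lia.
  congr (zbra _ _).
  by apply/eq_in_map => i ir; rewrite ifF //; apply: contraNF jr => /eqP <-.
rewrite !bj opprK [LHS]addrC; congr (_ + _).
apply: eq_big_seq => i ir; rewrite !zbra_cons.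
have ji e : bump1 f i e j = f j.
  by rewrite /bump1 ifF //; apply: contraNF jr => /eqP ->.
by rewrite !ji.
Qed.

End Pairing.

(** * Hyperoctahedral antisymmetry of the bras *)

Section Antisymmetry.
Variables (C : fieldType) (M : fockSpace C).
Hypothesis C0 : forall n : nat, n.+1%:R != 0 :> C.
Variables (n : nat).
Implicit Types (w : M) (q : {ffun 'I_n -> int}).

(* The coordinates [q] are the entries of the bra shifted by rho. *)
Definition latbra w q : C :=
  zbra [seq q i - (n - i.+1)%N%:Z | i : 'I_n <- enum 'I_n] w.

(** In shifted coordinates the exchange of p, q into q - 1, p + 1 from [zbra_swap] is a plain
    transposition. *)
Lemma latbra_adjacent w q (i j : 'I_n) : nat_of_ord j = i.+1 ->
  latbra w [ffun k => q (tperm i j k)] = - latbra w q.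
Proof.
move=> ij; set E := enum 'I_n.
have Esz : size E = n by exact: size_enum_ord.
have En (k : 'I_n) : nth i E k = k by exact: nth_ord_enum.
have EE : E = take i E ++ i :: j :: drop j.+1 E.
  rewrite -{1}(cat_take_drop i E); congr (_ ++ _).
  rewrite (drop_nth i) ?Esz // En; congr (_ :: _).
  have Ed : drop j E = nth i E j :: drop j.+1 E by apply: drop_nth; rewrite Esz.
  by rewrite -[i.+1]ij [LHS]Ed En.
have := enum_uniq 'I_n; rewrite -/E EE cat_uniq /=.
rewrite !inE !negb_or => /and3P[_ /and3P[i1 j1 _] /andP[/andP[nij i2] /andP[j2 _]]].
rewrite /latbra -/E EE !map_cat /= !ffunE tpermL tpermR.
rewrite [in RHS](zbra_swap C0) opprK.
have -> : q j - (n - j.+1)%N%:Z - 1 = q j - (n - i.+1)%N%:Z.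
  by have := ltn_ord j; lia.
have -> : q i - (n - i.+1)%N%:Z + 1 = q i - (n - j.+1)%N%:Z.
  by have := ltn_ord j; lia.
congr (zbra (_ ++ _ :: _ :: _) w).
- apply/eq_in_map => k kE; rewrite ffunE tpermD //.
    by apply: contraTneq kE => <-.
  by apply: contraTneq kE => <-.
- apply/eq_in_map => k kE; rewrite ffunE tpermD //.
    by apply: contraTneq kE => <-.
  by apply: contraTneq kE => <-.
Qed.

Lemma latbra_perm w q (s : {perm 'I_n}) :
  latbra w [ffun k => q (s k)] = (-1) ^+ s * latbra w q.
Proof.
pose good (s : {perm 'I_n}) := forall q,
  latbra w [ffun k => q (s k)] = (-1) ^+ s * latbra w q.
have goodM s1 s2 : good s1 -> good s2 -> good (s1 * s2)%g.
  move=> g1 g2 r; have -> : [ffun k => r ((s1 * s2)%g k)] =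
      [ffun k => [ffun k => r (s2 k)] (s1 k)].
    by apply/ffunP => k; rewrite !ffunE permM.
  by rewrite g1 g2 mulrA odd_permM signr_addb.
have goodt (d : nat) (i j : 'I_n) : nat_of_ord j = (i + d.+1)%N -> good (tperm i j).
  elim: d i j => [|d IH] i j ij.
    move=> r; rewrite latbra_adjacent ?ij ?addn1 //.
    have -> : odd_perm (tperm i j) by rewrite odd_tperm -val_eqE /=; lia.
    by rewrite expr1 mulN1r.
  have kn : (i + d.+1 < n)%N by have := ltn_ord j; rewrite ij; lia.
  (* [k] is the neighbour of [j] towards [i]; conjugation by the adjacent transposition of k and j
     reduces the distance by one. *)
  pose k := Ordinal kn.
  have kj : good (tperm k j).
    move=> r; rewrite latbra_adjacent; last by rewrite ij /=; lia.
    have -> : odd_perm (tperm k j) by rewrite odd_tperm -val_eqE /=; lia.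
    by rewrite expr1 mulN1r.
  have -> : tperm i j = (tperm k j * tperm i k * tperm k j)%g.
    have := tpermJ i k (tperm k j); rewrite tpermL tpermD => [<-||].
    - by rewrite conjgE tpermV mulgA.
    - by rewrite -val_eqE /=; lia.
    - by rewrite -val_eqE /=; lia.
  by apply: (goodM _ _ (goodM _ _ kj (IH _ _ _)) kj).
suff : good s by exact.
have [ts -> /allP tsd] := prod_tpermP s.
elim: ts tsd => [|[i j] ts IH] tsd.
  by rewrite big_nil => r; rewrite odd_perm1 mul1r; congr latbra;
    apply/ffunP => k; rewrite ffunE perm1.
rewrite big_cons; apply: (goodM); last first.
  by apply: IH => t tt; apply: tsd; rewrite inE tt orbT.
have /= : dpair (i, j) by apply: tsd; rewrite inE eqxx.
rewrite -val_eqE /= => ij.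
have [lij|lji] := ltnP i j; first by apply: (goodt (j - i).-1); lia.
by rewrite tpermC; apply: (goodt (i - j).-1); lia.
Qed.

Definition flip1 (i : 'I_n) q : {ffun 'I_n -> int} :=
  [ffun k => if k == i then - q k - 1 else q k].

Lemma latbra_flip_last w q (i : 'I_n) : i.+1 = n ->
  latbra w (flip1 i q) = - latbra w q.
Proof.
move=> il; set E := enum 'I_n.
have Esz : size E = n by exact: size_enum_ord.
have En (k : 'I_n) : nth i E k = k by exact: nth_ord_enum.
have EE : E = rcons (take i E) i.
  rewrite -{1}(cat_take_drop i E) -cats1; congr (_ ++ _).
  by rewrite (drop_nth i) ?Esz // En il drop_oversize ?Esz.
have := enum_uniq 'I_n; rewrite -/E EE rcons_uniq => /andP[iE _].
rewrite /latbra -/E EE !map_rcons [in LHS](zbra_last C0) /flip1 ffunE eqxx il subnn.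
have -> : - (- q i - 1 - 0%N%:Z) - 1 = q i - 0%N%:Z by lia.
congr (- zbra (rcons _ _) w).
by apply/eq_in_map => k kE; rewrite ffunE ifF //; apply: contraTF kE => /eqP ->.
Qed.

(** Only the entry next to the dual vacuum can be reflected, so coordinate i is exchanged with the
    last one and back; the two permutation signs cancel. *)
Lemma latbra_flip w q (i : 'I_n) : latbra w (flip1 i q) = - latbra w q.
Proof.
have n0 : (n.-1 < n)%N by have := ltn_ord i; lia.
pose l := Ordinal n0; pose s := tperm i l.
have -> : flip1 i q = [ffun k => flip1 l [ffun k => q (s k)] (s k)].
  apply/ffunP => k; rewrite !ffunE /s tpermK.
  have -> // : (tperm i l k == l) = (k == i).
  by rewrite -{2}(tpermL i l) (inj_eq perm_inj).
rewrite latbra_perm latbra_flip_last; last by rewrite /=; lia.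
by rewrite latbra_perm mulrN mulrA -expr2 sqrr_sign mul1r.
Qed.

End Antisymmetry.

(** * Strictly decreasing representatives of permutation orbits *)

Section StrictlyDecreasing.
Variables (n B : nat).
Implicit Types (k f : {ffun 'I_n -> 'I_B}) (s : {perm 'I_n}).

Definition sdec k := [forall i : 'I_n, forall j : 'I_n, (i < j)%N ==> (k j < k i)%N].

Lemma sdecP k : reflect (forall i j : 'I_n, (i < j)%N -> (k j < k i)%N) (sdec k).
Proof.
apply: (iffP forallP) => [H i j ij|H i]; first by have /forallP/(_ j)/implyP := H i; exact.
by apply/forallP => j; apply/implyP; exact: H.
Qed.

Lemma sdec_inj k : sdec k -> injective k.
Proof.
move=> /sdecP H i j kij; apply: val_inj; apply/eqP.
by case: (ltngtP i j) => // /H; rewrite kij ltnn.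
Qed.

(** This makes the subtraction of rho exact in the naturals. *)
Lemma sdec_ge k (i : 'I_n) : sdec k -> (n - i.+1 <= k i)%N.
Proof.
move=> /sdecP H; have [d] := ubnP (n - i.+1); elim: d i => // d IH i ind.
have [ni|ni] := leqP n i.+1; first by move: ni; rewrite -subn_eq0 => /eqP ->.
have ik := H i (Ordinal ni) (leqnn _); have := IH (Ordinal ni); rewrite /= => h.
have : (n - i.+2 <= k (Ordinal ni))%N by apply: h; lia.
by lia.
Qed.

Definition ffun_perm (p : {ffun 'I_n -> 'I_B} * {perm 'I_n}) : {ffun 'I_n -> 'I_B} :=
  [ffun i => p.1 (p.2 i)].

Lemma sdec_sorted k : sdec k -> sorted (fun x y : 'I_B => (y < x)%N) (codom k).
Proof.
move=> /sdecP H; rewrite codomE; case: n k H => [|m] k H.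
  by rewrite (size0nil (size_enum_ord 0)).
apply: (@homo_sorted _ _ _ (fun i j : 'I_m.+1 => (i < j)%N)
  (fun x y : 'I_B => (y < x)%N)); last first.
  have := iota_ltn_sorted 0 m.+1; rewrite -val_enum_ord sorted_map; exact.
by move=> i j; exact: H.
Qed.

Lemma ffun_perm_inj : {in [set p | sdec p.1]%SET &, injective ffun_perm}.
Proof.
move=> [k s] [k' s']; rewrite !inE /= => Hk Hk' /ffunP E.
have e i : k (s i) = k' (s' i) by have := E i; rewrite !ffunE.
have kk' : codom k =i codom k'.
  move=> x; apply/codomP/codomP => -[i ->].
    by exists (s' (s^-1%g i)); rewrite -e permKV.
  by exists (s (s'^-1%g i)); rewrite e permKV.
have ck : codom k = codom k'.
  apply: (@irr_sorted_eq _ (fun x y : 'I_B => (y < x)%N)) (sdec_sorted Hk) (sdec_sorted Hk') kk'.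
    by move=> y x z xy yz; exact: ltn_trans yz xy.
  by move=> x; rewrite /= ltnn.
have {}ck : k = k'.
  apply/ffunP => i; move: ck; rewrite !codomE => /eq_in_map; apply.
  by rewrite mem_enum.
rewrite ck; congr (_, _); apply/permP => i.
by apply: (sdec_inj Hk'); rewrite -e ck.
Qed.

Lemma ffun_perm_image : (ffun_perm @: [set p | sdec p.1] =
  [set f : {ffun 'I_n -> 'I_B} | injectiveb f])%SET.
Proof.
apply/setP => f; rewrite inE; apply/imsetP/injectiveP => [[[k s]]|f_inj].
  by rewrite inE /= => /sdec_inj kI -> i j; rewrite !ffunE => /kI /perm_inj.
case: (posnP n) => [n0|n_gt0].
  have noI (i : 'I_n) : False by have := ltn_ord i; rewrite {2}n0.
  exists (f, 1%g); last by apply/ffunP => i; case: (noI i).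
  by rewrite inE; apply/sdecP => i; case: (noI i).
pose i0 := Ordinal n_gt0.
pose S := sort (fun x y : 'I_B => (y <= x)%N) (codom f).
have Smem x : (x \in S) = (x \in codom f) by rewrite mem_sort.
have Su : uniq S by rewrite sort_uniq; apply/injectiveP.
have Ssz : size S = n by rewrite size_sort size_codom card_ord.
have Ss : sorted (fun x y : 'I_B => (y <= x)%N) S.
  by apply: sort_sorted => x y; exact: leq_total.
pose k := [ffun i : 'I_n => nth (f i0) S i].
have ix i : (index (f i) S < n)%N by rewrite -[X in (_ < X)%N]Ssz index_mem Smem codom_f.
pose s0 i := Ordinal (ix i).
have s0K i : nth (f i0) S (s0 i) = f i by rewrite nth_index // Smem codom_f.
have s0I : injective s0.
  by move=> i j ij; apply: f_inj; rewrite -s0K ij s0K.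
exists (k, perm s0I); last by apply/ffunP => i; rewrite !ffunE permE s0K.
rewrite inE; apply/sdecP => i j ij; rewrite !ffunE ltn_neqAle; apply/andP; split.
  rewrite (inj_eq val_inj) nth_uniq ?Ssz //.
  by rewrite neq_ltn ij orbT.
have tr : transitive (fun x y : 'I_B => (y <= x)%N).
  by move=> y x z xy yz; exact: leq_trans yz xy.
by apply: (sorted_ltn_nth tr) => //; rewrite inE Ssz.
Qed.

End StrictlyDecreasing.

(** * Antisymmetric lattice sums as sums of alternants *)

Section AlternatingSums.
Variables (K : fieldType) (n : nat) (t : 'I_n -> K).
Hypothesis K2 : 2%:R != 0 :> K.
Implicit Types (q : {ffun 'I_n -> int}).
Variable c : {ffun 'I_n -> int} -> K.
Hypothesis c_fin : fin_supp c.
Hypothesis c_perm : forall q (s : {perm 'I_n}),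
  c [ffun i => q (s i)] = (-1) ^+ s * c q.
Hypothesis c_flip : forall q i, c (flip1 i q) = - c q.

Definition latmono q : K := \prod_i (t i) ^ (q i *+ 2 + 1).

Let wt (i : 'I_n) (k : nat) : K := t i ^+ k.*2.+1 - t i ^- k.*2.+1.

Let lift_ffun B (k : {ffun 'I_n -> 'I_B}) : {ffun 'I_n -> int} :=
  [ffun i => (k i : nat)%:Z].

Lemma alt_eq0 q (i j : 'I_n) : i != j -> q i = q j -> c q = 0.
Proof.
move=> ij qij; have := c_perm q (tperm i j).
have -> : [ffun k => q (tperm i j k)] = q.
  by apply/ffunP => k; rewrite ffunE; case: tpermP => [->|->|].
rewrite odd_tperm ij expr1 mulN1r => /eqP.
by rewrite -addr_eq0 -mulr2n -mulr_natl mulf_eq0 (negbTE K2) => /eqP.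
Qed.

(** Terms with a repeated value vanish by antisymmetry; an injective function is uniquely a strictly
    decreasing one composed with a permutation, and the signs of the permutations assemble the
    Leibniz formula. *)
Lemma alt_sum_sdec B :
  \sum_(k : {ffun 'I_n -> 'I_B}) c (lift_ffun k) * \prod_i wt i (k i) =
  \sum_(k : {ffun 'I_n -> 'I_B} | sdec k)
     c (lift_ffun k) * \det (\matrix_(i, j) wt i (k j)).
Proof.
pose G (f : {ffun 'I_n -> 'I_B}) := c (lift_ffun f) * \prod_i wt i (f i).
transitivity (\sum_(f in [set f : {ffun 'I_n -> 'I_B} | injectiveb f]%SET) G f).
  rewrite [RHS]big_mkcond; apply: eq_bigr => f _; rewrite inE.
  case: ifP => // /injectiveP fI; rewrite (_ : c _ = 0) ?mul0r //.
  have /injectivePn[i [j ij fij]] : ~~ injectiveb f by apply/injectiveP.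
  by apply: (alt_eq0 ij); rewrite !ffunE fij.
rewrite -ffun_perm_image big_imset /=; last exact: ffun_perm_inj.
rewrite (eq_bigl (fun p : {ffun 'I_n -> 'I_B} * {perm 'I_n} => sdec p.1 && true)); last first.
  by move=> p; rewrite inE andbT.
rewrite -(pair_big (fun k => sdec k) xpredT (fun k s => G (ffun_perm (k, s)))) /=.
apply: eq_bigr => k _; rewrite /determinant mulr_sumr; apply: eq_bigr => s _.
rewrite /G /ffun_perm /=.
have -> : lift_ffun [ffun i => k (s i)] = [ffun i => lift_ffun k (s i)].
  by apply/ffunP => i; rewrite !ffunE.
rewrite c_perm -mulrA mulrCA; congr (_ * (_ * _)).
by apply: eq_bigr => i _; rewrite mxE ffunE.
Qed.

Definition signed (k : int) (b : bool) : int := if b then - k - 1 else k.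

Lemma alt_signed q (b : {ffun 'I_n -> bool}) :
  c [ffun i => signed (q i) (b i)] = (\prod_i (-1) ^+ b i) * c q.
Proof.
suff H (r : seq 'I_n) : uniq r ->
    c [ffun i => if i \in r then signed (q i) (b i) else q i] =
    (\prod_(i <- r) (-1) ^+ b i) * c q.
  rewrite -(H _ (index_enum_uniq _)); congr c; apply/ffunP => i.
  by rewrite !ffunE mem_index_enum.
elim: r => [|j r IH] /=.
  by rewrite big_nil mul1r => _; congr c; apply/ffunP => i; rewrite ffunE.
case/andP=> jr ur; rewrite big_cons -mulrA -IH //.
case bj: (b j); last first.
  rewrite mul1r; congr c; apply/ffunP => i; rewrite !ffunE inE.
  by case: eqP => // ->; rewrite (negbTE jr) /signed bj.
rewrite mulN1r -(c_flip _ j); congr c; apply/ffunP => i; rewrite !ffunE inE.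
by case: eqP => // ->; rewrite (negbTE jr) /signed bj.
Qed.

(** An upper bound is enough, since [c_flip] turns it into a lower one. *)
Lemma alt_bound : exists B : nat, forall q i, B%:Z <= q i -> c q = 0.
Proof.
have /fin_suppP[r rP] := c_fin.
exists (\max_(q <- r) \max_i absz (q i)).+1 => q i qi; apply: rP.
apply/negP => qr.
have h1 : (absz (q i) <= \max_j absz (q j))%N.
  exact: (@leq_bigmax _ (fun j => absz (q j))).
have h2 : (\max_j absz (q j) <= \max_(q <- r) \max_i absz (q i))%N.
  exact: (leq_bigmax_seq (F := fun q : {ffun 'I_n -> int} => (\max_j absz (q j))%N)).
by lia.
Qed.

Definition rho_shift (mu : n.-tuple nat) : {ffun 'I_n -> int} :=
  [ffun i => (tnth mu i + (n - i.+1))%N%:Z].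

Let dec B (p : {ffun 'I_n -> 'I_B} * {ffun 'I_n -> bool}) : {ffun 'I_n -> int} :=
  [ffun i => signed (lift_ffun p.1 i) (p.2 i)].

(** Each integer is [signed k b] for exactly one natural k and one b, so q splits into sizes and
    signs; the sum over the signs factors into the differences [wt]. *)
Lemma alt_sum_finite B : (forall q i, B%:Z <= q i -> c q = 0) ->
  \sum_(q \in [set: {ffun 'I_n -> int}]) c q * latmono q =
  \sum_(k : {ffun 'I_n -> 'I_B}) c (lift_ffun k) * \prod_i wt i (k i).
Proof.
move=> cB; pose r := [seq dec p | p : {ffun 'I_n -> 'I_B} * {ffun 'I_n -> bool}].
have dec_inj : injective (@dec B).
  move=> [k b] [k' b'] /ffunP E.
  have e i : signed (k i : nat)%:Z (b i) = signed (k' i : nat)%:Z (b' i).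
    by have := E i; rewrite !ffunE.
  congr (_, _); apply/ffunP => i; have := e i; rewrite /signed.
    by move=> ei; apply: val_inj; move: ei => /=; case: (b i); case: (b' i); lia.
  by case: (b i); case: (b' i) => //; lia.
rewrite (@fsumT_seq _ _ r); last first.
  move=> q qr; rewrite (_ : c q = 0) ?mul0r //.
  apply/eqP; apply: contraNT qr => cq.
  have qB i : q i < B%:Z.
    by rewrite ltNge; apply: contraNN cq => qi; apply/eqP; exact: cB qi.
  have qB' i : - q i - 1 < B%:Z.
    rewrite ltNge; apply: contraNN cq => qi; rewrite -oppr_eq0 -(c_flip q i).
    by apply/eqP/(cB _ i); rewrite ffunE eqxx.
  have vB i : (absz (signed (q i) (q i < 0)%R) < B)%N.
    by have := qB i; have := qB' i; rewrite /signed; case: (ltP (q i) 0); lia.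
  apply/mapP; exists ([ffun i => Ordinal (vB i)], [ffun i => q i < 0]).
    by rewrite mem_enum.
  have sK (z : int) : z = signed (absz (signed z (z < 0)%R))%:Z (z < 0).
    by rewrite /signed; case: (ltP z 0); lia.
  by apply/ffunP => i; rewrite !ffunE -[RHS]sK.
rewrite undup_id; last by rewrite map_inj_uniq ?enum_uniq.
rewrite big_map big_enum /=.
rewrite -(pair_big xpredT xpredT (fun k b => c (dec (k, b)) * latmono (dec (k, b)))) /=.
apply: eq_bigr => k _.
have wtE i : wt i (k i) =
    \sum_(b : bool) (-1) ^+ b * t i ^ (signed (k i : nat)%:Z b *+ 2 + 1).
  rewrite big_bool /= expr1 expr0 mulN1r mul1r addrC /wt /signed.
  have -> : (- (k i)%:Z - 1) *+ 2 + 1 = - (k i).*2.+1%:Z :> int by lia.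
  have -> : (k i)%:Z *+ 2 + 1 = (k i).*2.+1%:Z :> int by lia.
  by rewrite exprnN exprnP.
under [in RHS]eq_bigr do rewrite wtE.
rewrite bigA_distr_bigA mulr_sumr; apply: eq_bigr => b _.
rewrite /dec /= alt_signed big_split /= -mulrA [RHS]mulrCA; congr (_ * (_ * _)).
by apply: eq_bigr => i _; rewrite !ffunE.
Qed.

Let mu_of B (k : {ffun 'I_n -> 'I_B}) : n.-tuple nat := [tuple (k i - (n - i.+1))%N | i < n].

Lemma rho_mu_of B (k : {ffun 'I_n -> 'I_B}) : sdec k -> rho_shift (mu_of k) = lift_ffun k.
Proof.
move=> kd; apply/ffunP => i; rewrite !ffunE tnth_mktuple.
by have := sdec_ge i kd; lia.
Qed.

Lemma mu_of_partition B (k : {ffun 'I_n -> 'I_B}) : sdec k -> gen_partition (mu_of k).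
Proof.
move=> kd; rewrite /gen_partition; case: (posnP n) => [n0|n_gt0].
  by rewrite (size0nil (_ : size (mu_of k) = 0%N)) // size_tuple.
apply/(sortedP 0%N) => i; rewrite size_tuple => iS.
have i0 : (i < n)%N by exact: ltnW.
have := tnth_nth 0%N (mu_of k) (Ordinal i0); rewrite tnth_mktuple /= => <-.
have := tnth_nth 0%N (mu_of k) (Ordinal iS); rewrite tnth_mktuple /= => <-.
have /sdecP/(_ (Ordinal i0) (Ordinal iS)) := kd; rewrite /= ltnSn => /(_ isT).
by have := sdec_ge (Ordinal iS) kd; rewrite /=; lia.
Qed.

Lemma partition_mu_of B (mu : n.-tuple nat) : gen_partition mu ->
  (forall i, rho_shift mu i < B%:Z) -> exists2 k : {ffun 'I_n -> 'I_B}, sdec k & mu = mu_of k.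
Proof.
move=> Pmu muB.
have vB (i : 'I_n) : (tnth mu i + (n - i.+1) < B)%N by have := muB i; rewrite ffunE.
exists [ffun i => Ordinal (vB i)].
  apply/sdecP => i j ij; rewrite !ffunE /=.
  have : (tnth mu j <= tnth mu i)%N.
    rewrite !(tnth_nth 0%N); apply: (sorted_ltn_nth (rev_trans leq_trans)) => //;
    by rewrite inE size_tuple.
  by have := ltn_ord j; lia.
by apply: eq_from_tnth => i; rewrite tnth_mktuple ffunE /= addnK.
Qed.

Theorem alt_sum :
  finite_set [set mu : n.-tuple nat | gen_partition mu /\ c (rho_shift mu) != 0] /\
  \sum_(q \in [set: {ffun 'I_n -> int}]) c q * latmono q =
  \sum_(mu \in [set mu : n.-tuple nat | gen_partition mu])
     c (rho_shift mu) * so_alternant mu t.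
Proof.
have [B cB] := alt_bound.
pose r := [seq mu_of k | k <- enum [pred k : {ffun 'I_n -> 'I_B} | sdec k]].
have rP (mu : n.-tuple nat) : gen_partition mu -> mu \notin r -> c (rho_shift mu) = 0.
  move=> Pmu mur; apply/eqP; apply: contraNT mur => cmu.
  have [i|k kd ->] := partition_mu_of (B := B) Pmu.
    by rewrite ltNge; apply: contraNN cmu => qi; apply/eqP; exact: cB qi.
  by apply/mapP; exists k; rewrite // mem_enum inE.
split.
  apply: (sub_finite_set _ (finite_seq r)) => mu /= [Pmu].
  by apply: contraNT => /(rP _ Pmu) ->.
rewrite (alt_sum_finite cB) alt_sum_sdec (fsbigE r).
- rewrite big_map big_enum_cond /=; apply: eq_big => [k|k kd].
    rewrite inE; case: (boolP (sdec k)) => // kd.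
    by symmetry; apply/mem_set; exact: mu_of_partition.
  rewrite rho_mu_of //; congr (_ * \det _); apply/matrixP => i j; rewrite !mxE.
  by rewrite /wt /so_exponent tnth_mktuple subnK // sdec_ge.
- rewrite map_inj_in_uniq ?enum_uniq // => k k'; rewrite !mem_enum !inE => kd kd' kk'.
  have := rho_mu_of kd; rewrite kk' rho_mu_of // => /ffunP e.
  by apply/ffunP => i; apply: val_inj; have := e i; rewrite !ffunE => -[].
- by move=> mu /= /mapP[k]; rewrite mem_enum inE => kd ->; exact: mu_of_partition.
- by move=> mu /= Pmu /(rP _ Pmu) ->; rewrite mul0r.
Qed.

End AlternatingSums.

(** * Interchange and reindexing of finitely supported sums *)

Section FiniteSumsBig.
Variables (I : choiceType) (V : zmodType) (J : Type).

Lemma fin_supp0 : fin_supp (fun _ : I => 0 : V).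
Proof. by apply/fin_suppP; exists [::]. Qed.

Lemma fin_supp_big (r : seq J) (F : J -> I -> V) : (forall j, fin_supp (F j)) ->
  fin_supp (fun i => \sum_(j <- r) F j i).
Proof.
move=> Ff; elim: r => [|j r IH].
  by under eq_fun do rewrite big_nil; exact: fin_supp0.
by under eq_fun do rewrite big_cons; exact: fin_suppD.
Qed.

Lemma fsumT_big (r : seq J) (F : J -> I -> V) : (forall j, fin_supp (F j)) ->
  \sum_(i \in [set: I]) \sum_(j <- r) F j i =
  \sum_(j <- r) \sum_(i \in [set: I]) F j i.
Proof.
move=> Ff; elim: r => [|j r IH].
  by rewrite big_nil fsbig1 // => i _; rewrite big_nil.
rewrite big_cons -IH -fsumTD //; last exact: fin_supp_big.
by apply: eq_fsbigr => i _; rewrite big_cons.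
Qed.

Lemma fin_supp_can (I' : choiceType) (F : I -> V) (h : I' -> I) (g : I -> I') :
  cancel h g ->
  fin_supp F -> fin_supp (fun i => F (h i)).
Proof.
move=> hK /fin_suppP[r rP]; apply/fin_suppP; exists (map g r) => i ir.
by apply: rP; apply: contra ir => hr; rewrite -(hK i) map_f.
Qed.

End FiniteSumsBig.

(** * The generating function of the bras *)

Section LatticeFunctional.
Variables (C : fieldType) (M : fockSpace C).
Hypothesis C0 : forall n : nat, n.+1%:R != 0 :> C.
Variables (K : fieldType) (iota : {rmorphism C -> K}).
Variables (n : nat) (t : 'I_n -> K).
Hypothesis t_neq0 : forall i, t i != 0.
Implicit Types (w : M) (q : {ffun 'I_n -> int}) (m : int).

Definition shift1 (i : 'I_n) m q : {ffun 'I_n -> int} := [ffun j => bump1 q i m j].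

Lemma shift1K i m : cancel (shift1 i m) (shift1 i (- m)).
Proof.
move=> q; apply/ffunP => j; rewrite !ffunE /bump1 !ffunE /bump1.
by case: eqP => //= _; rewrite addrK.
Qed.

Lemma shift1NK i m : cancel (shift1 i (- m)) (shift1 i m).
Proof. by move=> q; have := shift1K i (- m) q; rewrite opprK. Qed.

Lemma latbra_lin (c : C) (u v : M) q :
  latbra (c *: u + v) q = c * latbra u q + latbra v q.
Proof. exact: zbra_lin. Qed.

Lemma latbra_cre m w q : 0 < m -> latbra (heis M (- m) w) q =
  \sum_(i < n) (latbra w (shift1 i m q) + latbra w (shift1 i (- m) q)).
Proof.
move=> m0; rewrite /latbra (zbra_cre C0) ?enum_uniq // big_enum /=.
have E i e : [seq bump1 (fun j : 'I_n => q j - (n - j.+1)%N%:Z) i e j | j <- enum 'I_n] =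
    [seq shift1 i e q j - (n - j.+1)%N%:Z | j <- enum 'I_n].
  by apply: eq_map => j; rewrite ffunE /bump1; case: eqP => //= _; rewrite addrAC.
by apply: eq_bigr => i _; rewrite !E.
Qed.

(** Moved to the first place, the coordinate gives an entry q_i - (n - 1) > 0, whose U* mode acts
    first and kills the vacuum. *)
Lemma latbra_vac_ge q (i : 'I_n) : n%:Z <= q i -> latbra (vac M) q = 0.
Proof.
move=> qi; have n0 : (0 < n)%N by have := ltn_ord i; lia.
pose i0 := Ordinal n0; pose s := tperm i0 i.
suff : latbra (vac M) [ffun k => q (s k)] = 0.
  by rewrite (latbra_perm C0) => /eqP; rewrite mulf_eq0 signr_eq0 => /eqP.
have E : enum 'I_n = i0 :: behead (enum 'I_n).
  have sz : size (enum 'I_n) = n by exact: size_enum_ord.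
  have h : nth i0 (enum 'I_n) i0 = i0 by exact: nth_ord_enum.
  case: (enum 'I_n) sz h => [|j r] /=; first by move=> z; exfalso; lia.
  by move=> _ ->.
rewrite /latbra E map_cons zbra_cons Ustar_vac ?zbra0 //.
by rewrite ffunE tpermL /=; lia.
Qed.

(** On the vacuum the support lies in the box - n <= q_i < n, the lower bound being the upper one
    reflected; creation operators only translate supports. *)
Lemma latbra_fin w : fin_supp (latbra w : {ffun 'I_n -> int} -> C).
Proof.
move: w; apply: vac_gen.
- apply/fin_suppP.
  exists [seq [ffun i => (f i : nat)%:Z - n%:Z] | f : {ffun 'I_n -> 'I_(n + n)}] => q qr.
  apply/eqP; apply: contraNT qr => cq.
  have q1 i : q i < n%:Z.
    by rewrite ltNge; apply: contraNN cq => qi; apply/eqP; exact: latbra_vac_ge qi.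
  have q2 i : - q i - 1 < n%:Z.
    rewrite ltNge; apply: contraNN cq => qi; rewrite -oppr_eq0 -(latbra_flip C0 _ _ i).
    by apply/eqP/(latbra_vac_ge (i := i)); rewrite ffunE eqxx.
  have vB i : (absz (q i + n%:Z)%R < n + n)%N by have := q1 i; have := q2 i; lia.
  apply/mapP; exists [ffun i => Ordinal (vB i)]; first by rewrite mem_enum.
  have zK (z : int) : - z - 1 < n%:Z -> z = (absz (z + n%:Z))%:Z - n%:Z by lia.
  by apply/ffunP => i; rewrite !ffunE; exact: zK.
- move=> c u v Hu Hv; have -> : latbra (c *: u + v) =
      (fun q : {ffun 'I_n -> int} => c * latbra u q + latbra v q).
    by apply/funext => q; exact: latbra_lin.
  apply: fin_suppD => //; apply: (@fin_supp_comp _ _ _ (fun x => c * x)) => //.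
  exact: mulr0.
- move=> m w m0 H; have -> : latbra (heis M (- m) w) =
      (fun q => \sum_(i < n) (latbra w (shift1 i m q) + latbra w (shift1 i (- m) q))).
    by apply/funext => q; exact: latbra_cre.
  apply: fin_supp_big => i; apply: fin_suppD.
    exact: (fin_supp_can (shift1K i m)).
  exact: (fin_supp_can (shift1NK i m)).
Qed.

Definition latsum w : K :=
  \sum_(q \in [set: {ffun 'I_n -> int}]) iota (latbra w q) * latmono t q.

Definition power_sum m : K := \sum_(i < n) (t i ^ (m *+ 2) + t i ^ (- (m *+ 2))).

Lemma fin_supp_iota (f : {ffun 'I_n -> int} -> C) (g : {ffun 'I_n -> int} -> K) :
  fin_supp f -> fin_supp (fun q => iota (f q) * g q).
Proof.
move=> /fin_suppP[r rP]; apply/fin_suppP; exists r => q /rP ->.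
by rewrite rmorph0 mul0r.
Qed.

Lemma latsum_lin (c : C) (u v : M) :
  latsum (c *: u + v) = iota c * latsum u + latsum v.
Proof.
rewrite /latsum mulr_fsumr -fsumTD; last 2 first.
- apply: (@fin_supp_comp _ _ _ (fun x => iota c * x)); rewrite ?mulr0 //.
  exact/fin_supp_iota/latbra_fin.
- exact/fin_supp_iota/latbra_fin.
by apply: eq_fsbigr => q _; rewrite latbra_lin rmorphD rmorphM mulrDl mulrA.
Qed.

Lemma latmono_shift i m q : latmono t (shift1 i m q) = t i ^ (m *+ 2) * latmono t q.
Proof.
rewrite /latmono (bigD1 i) // [in RHS](bigD1 i) //= mulrA ffunE /bump1 eqxx.
rewrite -expfzDr // mulrnDl addrAC addrC; congr (_ * _).
apply: eq_bigr => j ji.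
by rewrite ffunE /bump1 (negbTE ji).
Qed.

Lemma latsum_shift i m w :
  \sum_(q \in [set: {ffun 'I_n -> int}]) iota (latbra w (shift1 i m q)) * latmono t q =
  t i ^ (- (m *+ 2)) * latsum w.
Proof.
rewrite (@reindex_fsbigT _ _ _ _ _ (shift1 i (- m))); last first.
  by exists (shift1 i m); [exact: shift1NK|exact: shift1K].
rewrite /latsum mulr_fsumr; apply: eq_fsbigr => q _.
by rewrite shift1NK latmono_shift mulNrn mulrCA.
Qed.

Lemma latsum_cre m w : 0 < m -> latsum (heis M (- m) w) = power_sum m * latsum w.
Proof.
move=> m0; rewrite /latsum /power_sum mulr_suml.
transitivity (\sum_(q \in [set: {ffun 'I_n -> int}]) \sum_(i < n)
    (iota (latbra w (shift1 i m q)) * latmono t q +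
     iota (latbra w (shift1 i (- m) q)) * latmono t q)).
  apply: eq_fsbigr => q _; rewrite latbra_cre // rmorph_sum mulr_suml.
  by apply: eq_bigr => i _; rewrite rmorphD mulrDl.
have Fp i : fin_supp (fun q => iota (latbra w (shift1 i m q)) * latmono t q).
  by apply: fin_supp_iota; apply: (fin_supp_can (shift1K i m)); exact: latbra_fin.
have Fm i : fin_supp (fun q => iota (latbra w (shift1 i (- m) q)) * latmono t q).
  by apply: fin_supp_iota; apply: (fin_supp_can (shift1NK i m)); exact: latbra_fin.
rewrite fsumT_big; last by move=> i; exact: fin_suppD.
apply: eq_bigr => i _.
rewrite (fsumTD (Fp i) (Fm i)) (latsum_shift i m w) (latsum_shift i (- m) w).
have -> : - ((- m) *+ 2) = m *+ 2 by lia.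
by rewrite mulrDl addrC.
Qed.

Lemma latbra_rho w (mu : n.-tuple nat) : latbra w (rho_shift mu) = so_bra mu w.
Proof.
rewrite so_braE /latbra; congr (zbra _ w).
rewrite -[in RHS](map_tnth_enum mu) -map_comp; apply: eq_map => i.
by rewrite ffunE PoszD addrK.
Qed.

Lemma latsum_alt w :
  finite_set [set mu : n.-tuple nat | gen_partition mu /\ iota (so_bra mu w) != 0] /\
  latsum w = \sum_(mu \in [set mu : n.-tuple nat | gen_partition mu])
    iota (so_bra mu w) * so_alternant mu t.
Proof.
have K2 : 2%:R != 0 :> K by rewrite -(rmorph_nat iota) fmorph_eq0.
have fin : fin_supp (fun q => iota (latbra w q)).
  by apply: (@fin_supp_comp _ _ _ iota); [exact: rmorph0|exact: latbra_fin].
have perm q (s : {perm 'I_n}) :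
    iota (latbra w [ffun i => q (s i)]) = (-1) ^+ s * iota (latbra w q).
  by rewrite (latbra_perm C0) rmorphM rmorph_sign.
have flip q i : iota (latbra w (flip1 i q)) = - iota (latbra w q).
  by rewrite (latbra_flip C0) rmorphN.
have [fs eqs] := alt_sum t K2 fin perm flip.
split; first by move: fs; under eq_set do rewrite latbra_rho.
by rewrite /latsum eqs; apply: eq_fsbigr => mu _; rewrite latbra_rho.
Qed.

Lemma latsum_vac : latsum (vac M) = so_alternant [tuple of nseq n 0%N] t.
Proof.
have P0 : gen_partition (nseq n 0%N).
  by rewrite /gen_partition; elim: (n) => [|[|k] IH].
have [_ ->] := latsum_alt (vac M); rewrite (fsbigE [:: [tuple of nseq n 0%N]]) //.
- rewrite big_cons big_nil mem_set // so_bra_vac // all_nseq /= orbT rmorph1.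
  by rewrite mul1r addr0.
- by move=> mu /=; rewrite inE => /eqP ->.
- move=> mu /= Pmu; rewrite inE => mu0; rewrite so_bra_vac //.
  rewrite (_ : all _ _ = false) ?rmorph0 ?mul0r //; apply: contraNF mu0 => /all_pred1P.
  by rewrite size_tuple => h; apply/eqP/val_inj.
Qed.

End LatticeFunctional.

(** * Nonvanishing of the Weyl denominator *)

Section Denominator.
Variables (K : fieldType) (n : nat) (t : 'I_n -> K).
Hypothesis t_neq0 : forall i, t i != 0.
Hypothesis t_inj : forall i j, i != j -> t i ^+ 2 != t j ^+ 2.
Hypothesis t_inv : forall i j, t i ^+ 2 * t j ^+ 2 != 1.

(* A vanishing determinant yields a polynomial of degree less than 2n with the
   2n roots t_i^2 and t_i^-2. *)
Lemma so_alternant0_neq0 : so_alternant [tuple of nseq n 0%N] t != 0.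
Proof.
rewrite /so_alternant -det_tr; apply/negP => /det0P[v v0 vA].
(* X^(2n-1-j) - X^j is X^(n-1/2) times the difference of the powers n-j-1/2 and -(n-j-1/2) of X, so
   p(t_i^2) is t_i^(2n-1) times the combination of matrix entries that [v] makes vanish. *)
pose p := \sum_(j < n) v 0 j *: ('X^(n + n - j.+1) - 'X^j) : {poly K}.
have vAi i : \sum_(j < n) v 0 j *
    (t i ^+ (n - j.+1).*2.+1 - t i ^- (n - j.+1).*2.+1) = 0.
  have /matrixP/(_ 0 i) := vA; rewrite !mxE => E; rewrite -[RHS]E.
  apply: eq_bigr => j _; rewrite !mxE /so_exponent.
  by rewrite (tnth_nth 0%N) nth_nseq; case: ifP; rewrite add0n.
(* The exponents j lie below n and the exponents 2n - 1 - j do not, so the coefficient of X^j is -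
   v_j. *)
have p0 : p != 0.
  apply: contraNneq v0 => p0; apply/eqP/rowP => j; rewrite mxE.
  have := congr1 (fun r : {poly K} => r`_j) p0; rewrite coef0 coef_sum.
  rewrite (bigD1 j) //= big1 => [|i ij].
    have jn : (nat_of_ord j == n + n - j.+1)%N = false by have := ltn_ord j; lia.
    rewrite coefZ coefB !coefXn eqxx jn.
    by rewrite sub0r addr0 mulrN1 => /eqP; rewrite oppr_eq0 => /eqP.
  have jn : (nat_of_ord j == n + n - i.+1)%N = false.
    by have := ltn_ord j; have := ltn_ord i; lia.
  have ji : (nat_of_ord j == i) = false by rewrite eq_sym; exact: negbTE ij.
  by rewrite coefZ coefB !coefXn jn ji subr0 mulr0.
have psz : (size p <= n + n)%N.
  apply: (leq_trans (size_sum _ _ _)); apply/bigmax_leqP => j _.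
  apply: (leq_trans (size_scale_leq _ _)); apply: (leq_trans (size_polyD _ _)).
  rewrite size_polyN !size_polyXn geq_max.
  by have := ltn_ord j; lia.
pose rs := [seq t i ^+ 2 | i <- enum 'I_n] ++ [seq t i ^- 2 | i <- enum 'I_n].
have rs_uniq : uniq rs.
  rewrite cat_uniq; apply/and3P; split.
  - rewrite map_inj_uniq ?enum_uniq // => i j /eqP h.
    by apply/eqP; apply: contraLR h; exact: t_inj.
  - apply/hasPn => x /mapP[j _ ->]; apply/mapP => -[i _ h].
    by have := t_inv i j; rewrite -h mulVf ?eqxx // expf_neq0.
  - rewrite map_inj_uniq ?enum_uniq // => i j /eqP h.
    by apply/eqP; apply: contraLR h => ij; rewrite (inj_eq invr_inj); exact: t_inj.
have rs_root : all (root p) rs.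
  rewrite all_cat; apply/andP; split; apply/allP => x /mapP[i _ ->]; rewrite /root.
    have -> : p.[t i ^+ 2] = t i ^+ (n + n - 1) * \sum_(j < n) v 0 j *
        (t i ^+ (n - j.+1).*2.+1 - t i ^- (n - j.+1).*2.+1).
      rewrite /p horner_sum mulr_sumr; apply: eq_bigr => j _.
      rewrite hornerZ hornerD hornerN !hornerXn -!exprM [RHS]mulrCA; congr (_ * _).
      rewrite mulrBr -exprD; congr (_ - _).
        by congr (_ ^+ _); have := ltn_ord j; lia.
      have -> : (n + n - 1 = 2 * j + (n - j.+1).*2.+1)%N by have := ltn_ord j; lia.
      by rewrite exprD mulfK // expf_neq0.
    by rewrite vAi mulr0.
  have -> : p.[t i ^- 2] = - (t i ^- (n + n - 1) * \sum_(j < n) v 0 j *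
      (t i ^+ (n - j.+1).*2.+1 - t i ^- (n - j.+1).*2.+1)).
    rewrite /p horner_sum mulr_sumr -sumrN; apply: eq_bigr => j _.
    rewrite hornerZ hornerD hornerN !hornerXn -!exprVn -!exprM [in RHS]mulrCA -mulrN.
    congr (_ * _); rewrite -mulrN opprB mulrBr -exprD; congr (_ - _).
      by congr (_ ^+ _); have := ltn_ord j; lia.
    have -> : (n + n - 1 = 2 * j + (n - j.+1).*2.+1)%N by have := ltn_ord j; lia.
    by rewrite exprD -mulrA -exprMn mulVf // expr1n mulr1.
  by rewrite vAi mulr0 oppr0.
have := max_poly_roots p0 rs_root rs_uniq.
by rewrite size_cat !size_map -enumT size_enum_ord ltnNge psz.
Qed.

End Denominator.

(** * Inserting [Gamma_+] into an eigenfunctional of the creation operators *)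

Section SkewFunctional.
Variables (C : fieldType) (M : fockSpace C).
Hypothesis C0 : forall n : nat, n.+1%:R != 0 :> C.
Variables (K : fieldType) (iota : {rmorphism C -> K}).

Definition iota_linear (F : M -> K) := forall (c : C) (u v : M),
  F (c *: u + v) = iota c * F u + F v.

Definition cre_eigen (P : int -> K) (F : M -> K) := forall (m : int) (w : M), 0 < m ->
  F (heis M (- m) w) = P m * F w.

Lemma cre_eigen_uniq P (F G : M -> K) : iota_linear F -> iota_linear G ->
  cre_eigen P F -> cre_eigen P G -> F (vac M) = G (vac M) -> forall w, F w = G w.
Proof.
move=> Fl Gl Fc Gc FG; apply: vac_gen => // [c u v Fu Fv|m w m0 Fw].
  by rewrite Fl Gl Fu Fv.
by rewrite Fc // Gc // Fw.
Qed.

Variables (N : nat) (x : 'I_N -> K).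
Hypothesis x_neq0 : forall i, x i != 0.
Local Notation idx := {ffun 'I_N -> int * int}.
Implicit Types (f : idx) (m : int) (w : M).

Definition gammas (r : seq 'I_N) f w : M :=
  foldr (fun i v => gmode (f i).1 (gmode (f i).2 v)) w r.

(* The Gamma modes indexed by integers, zero outside the naturals, so that
   shifts of the index are bijections. *)
Definition zgamma f w : M := gammas (enum 'I_N) f w.

Definition zmono f : K := \prod_i (x i ^ (f i).1 * (x i)^-1 ^ (f i).2).

Definition shift2 (i : 'I_N) (b : bool) m f : idx :=
  [ffun j => if j == i then
     if b then ((f j).1 + m, (f j).2) else ((f j).1, (f j).2 + m) else f j].

Lemma shift2K i b m : cancel (shift2 i b m) (shift2 i b (- m)).
Proof.
move=> f; apply/ffunP => j; rewrite !ffunE; case: eqP => // _.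
by case: b; rewrite /= addrK -surjective_pairing.
Qed.

Lemma shift2NK i b m : cancel (shift2 i b (- m)) (shift2 i b m).
Proof. by move=> f; have := shift2K i b (- m) f; rewrite opprK. Qed.

Lemma gammas_lin r f (c : C) (u v : M) :
  gammas r f (c *: u + v) = c *: gammas r f u + gammas r f v.
Proof. by elim: r => //= i r ->; rewrite !gmode_lin. Qed.

Lemma gammas_eq (r : seq 'I_N) (f g : idx) w : {in r, f =1 g} -> gammas r f w = gammas r g w.
Proof.
elim: r => //= i r IH fg; rewrite fg ?inE ?eqxx // IH // => j jr.
by apply: fg; rewrite inE jr orbT.
Qed.

Lemma gmodeD k (u v : M) : gmode k (u + v) = gmode k u + gmode k v.
Proof. exact: (linfD (gmode_lin k)). Qed.

Lemma gammas_cre r f m w : uniq r -> 0 < m -> gammas r f (heis M (- m) w) =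
  heis M (- m) (gammas r f w) + \sum_(i <- r)
    (gammas r (shift2 i true (- m) f) w + gammas r (shift2 i false (- m) f) w).
Proof.
move=> + m0; elim: r => [|j r IH] /=; first by rewrite big_nil addr0.
case/andP=> jr ur; rewrite IH // big_cons !gmodeD.
rewrite !(@linf_sum _ _ _ (gmode_lin _) _ r).
rewrite (gmode_cre C0 _ _ m0) gmodeD (gmode_cre C0 _ _ m0).
have rj b : gammas r (shift2 j b (- m) f) w = gammas r f w.
  apply: gammas_eq => i ir; rewrite ffunE ifF //.
  by apply: contraTF ir => /eqP ->.
have jj b : shift2 j b (- m) f j =
    if b then ((f j).1 - m, (f j).2) else ((f j).1, (f j).2 - m).
  by rewrite ffunE eqxx.
rewrite !rj !jj /= -!addrA; congr (_ + (_ + (_ + _))).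
apply: eq_big_seq => i ir.
have ij b : shift2 i b (- m) f j = f j.
  by rewrite ffunE ifF //; apply: contraNF jr => /eqP ->.
by rewrite !gmodeD !ij.
Qed.

Lemma gammas_vac r f :
  gammas r f (vac M) = if all (fun i => f i == (0, 0)) r then vac M else 0.
Proof.
elim: r => //= i r ->.
case: ifP => ar; last by rewrite !(linf0 (gmode_lin _)) andbF.
rewrite andbT !gmode_vac /dist_const; case: (f i) => a b /=.
have [-> /=|b0] := eqVneq b 0.
  by rewrite gmode_vac /dist_const xpair_eqE eqxx andbT.
by rewrite (linf0 (gmode_lin _)) xpair_eqE (negbTE b0) andbF.
Qed.

Lemma gammas_neg r f w (i : 'I_N) : i \in r -> ((f i).1 < 0) || ((f i).2 < 0) ->
  gammas r f w = 0.
Proof.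
move=> + fi; elim: r => //= j r IH; rewrite inE => /orP[/eqP <-|/IH ->].
  case/orP: fi => h; first by rewrite (gmode_neg C0).
  by rewrite (gmode_neg C0 _ h) (linf0 (gmode_lin _)).
by rewrite !(linf0 (gmode_lin _)).
Qed.

Lemma zgamma_fin w : fin_supp (fun f => zgamma f w).
Proof.
move: w; apply: vac_gen.
- apply/fin_suppP; exists [:: [ffun=> (0, 0)]] => f; rewrite inE /zgamma gammas_vac.
  case: allP => // f0 /eqP []; apply/ffunP => i; rewrite ffunE.
  by apply/eqP/f0; rewrite mem_enum.
- move=> c u v Hu Hv; under eq_fun do rewrite /zgamma gammas_lin.
  apply: fin_suppD => //; apply: (@fin_supp_comp _ _ _ (fun v => c *: v)) => //.
  exact: scaler0.
- move=> m w m0 H.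
  under eq_fun do rewrite /zgamma (gammas_cre _ _ (enum_uniq _) m0).
  apply: fin_suppD.
    by apply: (@fin_supp_comp _ _ _ (heis M (- m)) (fun f => zgamma f w)) => //;
      exact: linear0.
  apply: fin_supp_big => i; apply: fin_suppD.
    exact: (fin_supp_can (shift2NK i true m) H).
  exact: (fin_supp_can (shift2NK i false m) H).
Qed.

Lemma zmono_shift i b m f :
  zmono (shift2 i b m f) = (if b then x i ^ m else x i ^ (- m)) * zmono f.
Proof.
rewrite /zmono (bigD1 i) // [in RHS](bigD1 i) //= mulrA ffunE eqxx.
congr (_ * _); last by apply: eq_bigr => j ji; rewrite ffunE (negbTE ji).
have xi : (x i)^-1 != 0 by rewrite invr_eq0.
case: b; rewrite /= expfzDr //; first by rewrite -mulrA mulrCA mulrA.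
by rewrite [(x i)^-1 ^ m]exprz_inv mulrA mulrC mulrA.
Qed.

Section Functional.
Variables (P : int -> K) (L : M -> K).
Hypothesis L_lin : iota_linear L.
Hypothesis L_cre : cre_eigen P L.

Lemma iota_linear0 : L 0 = 0.
Proof. by have := L_lin (-1) 0 0; rewrite scaler0 addr0 rmorphN1 mulN1r addNr. Qed.

Lemma iota_linearD u v : L (u + v) = L u + L v.
Proof. by have := L_lin 1 u v; rewrite scale1r rmorph1 mul1r. Qed.

Definition gamma_sum w : K := \sum_(f \in [set: idx]) L (zgamma f w) * zmono f.

Lemma gamma_sum_fin w (F : idx -> idx) (G : idx -> idx) : cancel F G ->
  fin_supp (fun f => L (zgamma (F f) w) * zmono f).
Proof.
move=> FK; have /fin_suppP[r rP] := fin_supp_can FK (zgamma_fin w).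
by apply/fin_suppP; exists r => f /rP ->; rewrite iota_linear0 mul0r.
Qed.

Lemma gamma_sum_lin : iota_linear gamma_sum.
Proof.
move=> c u v; rewrite /gamma_sum mulr_fsumr -fsumTD.
- by apply: eq_fsbigr => f _; rewrite /zgamma gammas_lin L_lin mulrDl mulrA.
- apply: (@fin_supp_comp _ _ _ (fun z => iota c * z)); rewrite ?mulr0 //.
  exact: (@gamma_sum_fin u id id).
- exact: (@gamma_sum_fin v id id).
Qed.

Lemma gamma_sum_shift i b m w :
  \sum_(f \in [set: idx]) L (zgamma (shift2 i b (- m) f) w) * zmono f =
  (if b then x i ^ m else x i ^ (- m)) * gamma_sum w.
Proof.
rewrite (@reindex_fsbigT _ _ _ _ _ (shift2 i b m)); last first.
  by exists (shift2 i b (- m)); [exact: shift2K|exact: shift2NK].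
rewrite /gamma_sum mulr_fsumr; apply: eq_fsbigr => f _.
by rewrite shift2K zmono_shift mulrCA.
Qed.

(** From Gamma_+(u) a_{-m} = (a_{-m} + u^m) Gamma_+(u): each of x_i and x_i^{-1} adds its m-th power
    to the eigenvalue. *)
Lemma gamma_sum_cre :
  cre_eigen (fun m => P m + \sum_(i < N) (x i ^ m + x i ^ (- m))) gamma_sum.
Proof.
move=> m w m0; rewrite mulrDl mulr_suml.
transitivity (\sum_(f \in [set: idx]) (P m * (L (zgamma f w) * zmono f) +
  \sum_(i < N) (L (zgamma (shift2 i true (- m) f) w) * zmono f +
                L (zgamma (shift2 i false (- m) f) w) * zmono f))).
  apply: eq_fsbigr => f _; rewrite /zgamma (gammas_cre _ _ (enum_uniq _) m0).
  rewrite iota_linearD L_cre // mulrDl mulrA big_enum (big_morph L iota_linearD iota_linear0) mulr_suml.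
  by congr (_ + _); apply: eq_bigr => i _; rewrite iota_linearD mulrDl.
have F1 : fin_supp (fun f => P m * (L (zgamma f w) * zmono f)).
  apply: (@fin_supp_comp _ _ _ (fun z => P m * z)); rewrite ?mulr0 //.
  exact: (@gamma_sum_fin w id id).
have F2 i b : fin_supp (fun f => L (zgamma (shift2 i b (- m) f) w) * zmono f).
  exact: (gamma_sum_fin w (shift2NK i b m)).
have F3 i : fin_supp (fun f => L (zgamma (shift2 i true (- m) f) w) * zmono f +
    L (zgamma (shift2 i false (- m) f) w) * zmono f) by exact: fin_suppD.
rewrite fsumTD //; last exact: fin_supp_big.
rewrite -mulr_fsumr -/(gamma_sum w); congr (_ + _).
rewrite fsumT_big //; apply: eq_bigr => i _.
rewrite fsumTD // (gamma_sum_shift i true) (gamma_sum_shift i false).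
by rewrite mulrDl.
Qed.

Lemma gamma_sum_vac : gamma_sum (vac M) = L (vac M).
Proof.
rewrite /gamma_sum (@fsumT_seq _ _ [:: [ffun=> (0, 0)]]) /=.
  rewrite big_cons big_nil addr0 /zgamma gammas_vac ifT; last first.
    by apply/allP => i _; rewrite ffunE.
  rewrite /zmono big1 ?mulr1 // => i _; rewrite ffunE /=.
  by rewrite !expr0z mulr1.
move=> f; rewrite inE /zgamma gammas_vac.
case: allP => [f0 /eqP []|_ _]; last by rewrite iota_linear0 mul0r.
by apply/ffunP => i; rewrite ffunE; apply/eqP/f0; rewrite mem_enum.
Qed.

Definition emb (e : {ffun 'I_N -> nat * nat}) : idx :=
  [ffun i => ((e i).1%:Z, (e i).2%:Z)].

Definition proj (f : idx) : {ffun 'I_N -> nat * nat} :=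
  [ffun i => (absz (f i).1, absz (f i).2)].

Lemma embK : cancel emb proj.
Proof. by move=> e; apply/ffunP => i; rewrite !ffunE /=; case: (e i). Qed.

Lemma Gamma_pmE e w : Gamma_pm_mode e w = zgamma (emb e) w.
Proof.
rewrite /Gamma_pm_mode /zgamma /gammas; elim: (enum _) => //= i r ->.
by rewrite ffunE.
Qed.

Lemma Gamma_pm_fin w : fin_supp (fun e : {ffun 'I_N -> nat * nat} => Gamma_pm_mode e w).
Proof.
under eq_fun do rewrite Gamma_pmE.
exact: (fin_supp_can embK (zgamma_fin w)).
Qed.

Lemma gamma_sumE w : gamma_sum w =
  \sum_(e \in [set: {ffun 'I_N -> nat * nat}]) L (Gamma_pm_mode e w) *
    \prod_(i < N) (x i ^+ (e i).1 * (x i)^-1 ^+ (e i).2).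
Proof.
rewrite /gamma_sum.
transitivity (\sum_(f \in emb @` [set: {ffun 'I_N -> nat * nat}])
    L (zgamma f w) * zmono f).
  symmetry; apply: fsbig_widen => // f [_ nf] /=.
  have [i fi] : exists i, ((f i).1 < 0) || ((f i).2 < 0).
    apply: contrapT => /forallNP h; apply: nf; exists (proj f) => //.
    apply/ffunP => i; rewrite !ffunE /=; have := h i; case: (f i) => a b /= /negP.
    by rewrite negb_or -!leNgt => /andP[a0 b0]; congr (_, _); lia.
  by rewrite /zgamma (gammas_neg _ (i := i)) ?mem_enum ?iota_linear0 ?mul0r.
rewrite fsbig_image; last by move=> e e' _ _; exact: (can_inj embK).
apply: eq_fsbigr => e _; rewrite Gamma_pmE; congr (_ * _).
by apply: eq_bigr => i _; rewrite ffunE.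
Qed.

End Functional.
End SkewFunctional.

(** * The branching rule *)

Section Branching.
Variables (C : fieldType) (M : fockSpace C).
Hypothesis C0 : forall n : nat, n.+1%:R != 0 :> C.
Variables (K : fieldType) (iota : {rmorphism C -> K}).

Definition generic n (t : 'I_n -> K) := [/\ forall i, t i != 0,
  forall i j, i != j -> t i ^+ 2 != t j ^+ 2 & forall i j, t i ^+ 2 * t j ^+ 2 != 1].

Lemma latsum_ket n (t : 'I_n -> K) (lambda : n.-tuple nat) : gen_partition lambda ->
  latsum iota t (so_ket M lambda) = so_alternant lambda t.
Proof.
move=> Pl; have [_ ->] := latsum_alt C0 iota t (so_ket M lambda).
rewrite (fsbigE [:: lambda]) //.
- rewrite big_cons big_nil mem_set // (so_bra_ket M C0) // eqxx rmorph1.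
  by rewrite /= mul1r addr0.
- by move=> mu /=; rewrite inE => /eqP ->.
- move=> mu /= Pmu; rewrite inE => ml; rewrite (so_bra_ket M C0) ?size_tuple //.
  by rewrite val_eqE (negbTE ml) rmorph0 mul0r.
Qed.

Variables (l N : nat) (t : 'I_(l + N) -> K) (lambda : (l + N).-tuple nat).
Hypothesis t_gen : generic t.
Hypothesis Plambda : gen_partition lambda.

Let sy (j : 'I_l) := t (lshift N j).
Let x (i : 'I_N) := t (rshift l i) ^+ 2.
Let d := so_alternant [tuple of nseq l 0%N] sy.

(* The vacuum expectation <0| Gamma_+(y) w >. *)
Let L (w : M) := d^-1 * latsum iota sy w.

Let t_neq0 i : t i != 0. Proof. by case: t_gen. Qed.

Lemma sub_generic : generic sy.
Proof.
case: t_gen => h1 h2 h3; split=> [i|i j ij|i j]; [exact: h1| |exact: h3].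
by apply: h2; rewrite (inj_eq (@lshift_inj _ _)).
Qed.

Let d_neq0 : d != 0.
Proof. by case: sub_generic => *; exact: so_alternant0_neq0. Qed.

Let L_lin : iota_linear iota L.
Proof. by move=> c u v; rewrite /L latsum_lin // mulrDr mulrCA. Qed.

Let L_cre : cre_eigen (power_sum sy) L.
Proof.
move=> m w m0; rewrite /L (latsum_cre C0 iota _ w m0) 1?mulrCA // => i.
exact: t_neq0.
Qed.

Lemma gamma_sum_ket : gamma_sum x L (so_ket M lambda) = so_char lambda t.
Proof.
pose D := so_alternant [tuple of nseq (l + N) 0%N] t.
have D_neq0 : D != 0 by case: t_gen => *; exact: so_alternant0_neq0.
have x_neq0 i : x i != 0 by rewrite expf_neq0.
rewrite /so_char -/D -(latsum_ket t Plambda) mulrC.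
apply: (cre_eigen_uniq (iota := iota) (P := power_sum t)
  (G := fun w => D^-1 * latsum iota t w)).
- exact: gamma_sum_lin.
- by move=> c u v; rewrite latsum_lin // mulrDr mulrCA.
(* The variables x are squares of the remaining t, so the power sums of y and x add up to that of
   all l + N variables. *)
- move=> m w m0; rewrite (gamma_sum_cre C0 x_neq0 L_lin L_cre w m0); congr (_ * _).
  rewrite /power_sum big_split_ord /=; congr (_ + _); apply: eq_bigr => i _.
  rewrite /x exprnP !exprz_exp.
  have -> : 2 * m = m *+ 2 by lia.
  by have -> : 2 * - m = - (m *+ 2) by lia.
- by move=> m w m0; rewrite (latsum_cre C0 iota t_neq0 w m0) mulrCA.
- by rewrite (gamma_sum_vac x L_lin) /L !latsum_vac // !mulVf.
Qed.

Lemma branching : let summand := fun mu : l.-tuple nat =>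
    so_char mu sy * skew_so M iota lambda mu x in
  finite_set [set mu : l.-tuple nat | gen_partition mu /\ summand mu != 0] /\
  so_char lambda t = \sum_(mu \in [set mu : l.-tuple nat | gen_partition mu]) summand mu.
Proof.
move=> summand; pose ket := so_ket M lambda.
pose X (e : {ffun 'I_N -> nat * nat}) :=
  \prod_(i < N) (x i ^+ (e i).1 * (x i)^-1 ^+ (e i).2).
have /fin_suppP[re reP] := Gamma_pm_fin C0 N ket.
(* Finitely many Gamma indices matter and each involves finitely many [mu]; one finite set serving
   them all allows the two sums to be exchanged. *)
pose S := \bigcup_(e in [set` re]) [set mu : l.-tuple nat |
  gen_partition mu /\ iota (so_bra mu (Gamma_pm_mode e ket)) != 0].
have Sfin : finite_set S.
  apply: bigcup_finite => [|e _]; first exact: finite_seq.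
  by have [] := latsum_alt C0 iota sy (Gamma_pm_mode e ket).
have SP (mu : l.-tuple nat) : S mu -> gen_partition mu by case=> e _ [].
have notS (mu : l.-tuple nat) (e : {ffun 'I_N -> nat * nat}) : gen_partition mu -> ~ S mu ->
    iota (so_bra mu (Gamma_pm_mode e ket)) = 0.
  move=> Pmu nS; have [er|/reP ->] := boolP (e \in re); last by rewrite so_bra0 rmorph0.
  by apply/eqP; apply: contra_notT nS => h; exists e.
have [rm rmE] : exists rm : seq (l.-tuple nat), S = [set` rm] by apply/finite_seqP.
have skewE (mu : l.-tuple nat) : skew_so M iota lambda mu x =
    \sum_(e <- undup re) iota (so_bra mu (Gamma_pm_mode e ket)) * X e.
  by apply: fsumT_seq => e /reP ->; rewrite so_bra0 rmorph0 mul0r.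
have summand0 (mu : l.-tuple nat) : gen_partition mu -> mu \notin undup rm -> summand mu = 0.
  rewrite mem_undup => Pmu mur; rewrite /summand skewE big1 ?mulr0 // => e _.
  by rewrite notS ?mul0r // rmE; apply/negP.
have rmP : [set` undup rm] `<=` [set mu : l.-tuple nat | gen_partition mu].
  by move=> mu /=; rewrite mem_undup => mur; apply: SP; rewrite rmE.
split.
  apply: (sub_finite_set _ (finite_seq (undup rm))) => mu /= [Pmu].
  by apply: contraNT => /(summand0 _ Pmu) ->.
rewrite (fsbigE (undup rm)) ?undup_uniq // -gamma_sum_ket (gamma_sumE C0 x L_lin).
rewrite (@fsumT_seq _ _ re); last first.
  by move=> e /reP ->; rewrite (iota_linear0 L_lin) mul0r.
transitivity (\sum_(e <- undup re) \sum_(mu <- undup rm |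
    mu \in [set mu : l.-tuple nat | gen_partition mu])
    so_char mu sy * (iota (so_bra mu (Gamma_pm_mode e ket)) * X e)).
  apply: eq_bigr => e _; have [_ LE] := latsum_alt C0 iota sy (Gamma_pm_mode e ket).
  rewrite /L LE (fsbigE (undup rm)) ?undup_uniq //.
    rewrite mulr_sumr mulr_suml; apply: eq_bigr => mu _.
    by rewrite /so_char -/d -/(X e); ring.
  move=> mu /= Pmu; rewrite mem_undup => mur; rewrite notS ?mul0r // rmE.
  exact/negP.
rewrite exchange_big /=; apply: eq_bigr => mu _.
by rewrite /summand skewE mulr_sumr.
Qed.

End Branching.

(** Evaluation separates the polynomials: at the point with all coordinates 1, at 0 for i and 1
    elsewhere, and at the origin. *)
Lemma sqrt_var_generic (C : fieldType) (n : nat) : generic (@sqrt_var C n).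
Proof.
have evalX (v : 'I_n -> C) i : meval v 'X_i = v i by exact: mevalXU.
split=> [i|i j ij|i j].
- rewrite tofrac_eq0; apply/eqP => /(congr1 (meval (fun=> 1))).
  by rewrite evalX meval0 => /eqP; rewrite oner_eq0.
- rewrite -!rmorphXn tofrac_eq; apply/eqP.
  move=> /(congr1 (meval (fun k => (k != i)%:R))).
  rewrite !rmorphXn /= !evalX eqxx eq_sym ij expr1n expr0n /= => /eqP.
  by rewrite eq_sym oner_eq0.
- rewrite -!rmorphXn -rmorphM -tofrac1 tofrac_eq; apply/eqP.
  move=> /(congr1 (meval (fun=> 0))).
  by rewrite rmorphM !rmorphXn /= !evalX rmorph1 expr0n mul0r => /eqP; rewrite eq_sym oner_eq0.
Qed.

Theorem mainTheorem2 (R : realType) (M : fockSpace R[i]) (l N : nat)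
    (hl : (1 <= l)%N) (hN : (1 <= N)%N)
    (lambda : (l + N).-tuple nat) (hlambda : gen_partition lambda) :
  let t := @sqrt_var R[i] (l + N) in
  let sy := fun j : 'I_l => t (lshift N j) in
  let x := fun i : 'I_N => t (rshift l i) ^+ 2 in
  let summand := fun mu : l.-tuple nat =>
    so_char mu sy * skew_so M (sqrt_field_cst R[i] (l + N)) lambda mu x in
  finite_set [set mu : l.-tuple nat | gen_partition mu /\ summand mu != 0]
  /\ so_char lambda t
     = \sum_(mu \in [set mu : l.-tuple nat | gen_partition mu]) summand mu.
Proof.
apply: branching => //; last exact: sqrt_var_generic.
by move=> n; rewrite pnatr_eq0.
Qed.
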